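(* Let $\alpha>0$ be a constant. There is a constant $C=C(\alpha)>0$ such that for every $n$ and every $\alpha$-dense set $A$ of $n$ points in general position in the plane, the edge set of the complete geometric graph $K_n[A]$ can be covered by at most $C\,n^{3/2}$ monotone paths, and such a covering can be computed in $O(n^2)$ time (with the implied constant depending only on $\alpha$). Consequently, the edge set of $K_n[A]$ can be decomposed (partitioned) into at most $C\,n^{3/2}$ monotone matchings (for a suitable constant $C=C(\alpha)$).
   Context: A set of points in the plane is in general position if no three of its points are collinear. For a constant $\alpha>0$, a set of $n$ points in the plane is $\alpha$-dense if the ratio between the longest and the shortest distance between two points in the set is at most $\alpha\sqrt n$. For an $n$-point set $A$ in general position in the plane, the complete geometric graph $K_n[A]$ has vertex set $A$, and its edges are all $\binom n2$ straight-line segments between points of $A$. A polygonal path $\xi=(v_1,v_2,\ldots,v_t)$ in $\mathbb{R}^2$ is monotone in direction $\mathbf{u}\in\mathbb{R}^2\setminus\{\mathbf{0}\}$ if $\langle \overrightarrow{v_iv_{i+1}},\mathbf{u}\rangle>0$ for $i=1,\ldots,t-1$; a path is monotone if it is monotone in some direction $\mathbf{u}\in\mathbb{R}^2\setminus\{\mathbf{0}\}$. A matching (of straight-line segments) is monotone in direction $\mathbf{u}\in\mathbb{R}^2\setminus\{\mathbf{0}\}$ if the projections of its edges onto $\mathbf{u}$ are pairwise disjoint intervals; a matching is monotone if it is monotone in some direction $\mathbf{u}\in\mathbb{R}^2\setminus\{\mathbf{0}\}$. Equivalently, a matching is monotone if its edge set is a subset of the edge set of a monotone path. Paths and matchings covering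 or decomposing the edge set of $K_n[A]$ are subgraphs of $K_n[A]$. A family of paths covers the edge set of $K_n[A]$ if every edge of $K_n[A]$ belongs to at least one path of the family. Running time is measured by the number of elementary operations (arithmetic operations and comparisons on coordinates, and writing out vertices of paths) given the coordinates of the points of $A$ as input. *)

(* Defs.v *)
From mathcomp Require Import all_boot all_order all_algebra finmap.
From mathcomp Require Import boolp classical_sets reals exp.

Set Implicit Arguments.
Unset Strict Implicit.
Unset Printing Implicit Defensive.

Import Order.TTheory GRing.Theory Num.Theory.
Local Open Scope ring_scope.

(* The library's norm on [R * R] is the max norm, so the Euclidean structure is
   defined here. *)
Notation plane R := (R * R)%type.

Section Geometry.
Variable R : realType.
Implicit Types (p q r u : plane R) (A : {fset plane R}).

Definition dot p q : R := p.1 * q.1 + p.2 * q.2.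

Definition dist p q : R := Num.sqrt (dot (q - p) (q - p)).

Definition collinear p q r : Prop :=
  exists (w : plane R) (c : R),
    w != 0 /\ [/\ dot w p = c, dot w q = c & dot w r = c].

Definition general_position A : Prop :=
  forall p q r, p \in A -> q \in A -> r \in A ->
    p != q -> q != r -> p != r -> ~ collinear p q r.

Definition distance_in A (d : R) : Prop :=
  exists p q, [/\ p \in A, q \in A, p != q & d = dist p q].

Definition longest_distance A (d : R) : Prop :=
  distance_in A d /\ forall d', distance_in A d' -> d' <= d.

Definition shortest_distance A (d : R) : Prop :=
  distance_in A d /\ forall d', distance_in A d' -> d <= d'.

(* Vacuously true when A has fewer than two points. *)
Definition alpha_dense (alpha : R) A : Prop :=
  forall dmax dmin, longest_distance A dmax -> shortest_distance A dmin ->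
    dmax / dmin <= alpha * Num.sqrt (#|` A|%:R).

(* An edge is represented by the set of its two endpoints. *)
Definition edges A : {fset {fset plane R}} :=
  [fset [fset x.1; x.2]%fset | x in [seq (p, q) | p <- A, q <- A] & x.1 != x.2]%fset.

Definition segment (e : {fset plane R}) : set (plane R) :=
  [set x | exists p q (t : R),
     [/\ p \in e, q \in e, 0 <= t <= 1 &
      x = ((1 - t) * p.1 + t * q.1, (1 - t) * p.2 + t * q.2)]]%classic.

Definition path_edges (s : seq (plane R)) : seq {fset plane R} :=
  [seq [fset x.1; x.2]%fset | x <- zip s (behead s)].

Definition monotone_path_in u (s : seq (plane R)) : bool :=
  sorted (fun v w => 0 < dot (w - v) u) s.

Definition monotone_path (s : seq (plane R)) : Prop :=
  exists2 u, u != 0 & monotone_path_in u s.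

Definition path_in A (s : seq (plane R)) : bool :=
  (s != [::]) && all (fun v => v \in A) s.

Definition monotone_path_cover A (F : seq (seq (plane R))) : Prop :=
  (forall s, s \in F -> path_in A s /\ monotone_path s) /\
  (forall e, e \in edges A -> exists2 s, s \in F & e \in path_edges s).

(* The projection onto the line spanned by [u], in the coordinate [<x, u>] of
   that line (the position along [u] multiplied by the length of [u]). *)
Definition projection u (e : {fset plane R}) : set R :=
  [set dot x u | x in segment e]%classic.

Definition matching A (M : {fset {fset plane R}}) : Prop :=
  (M `<=` edges A)%fset /\ trivIfset M.

Definition monotone_matching A (M : {fset {fset plane R}}) : Prop :=
  matching A M /\
  exists2 u, u != 0 & trivIset [set` M]%classic (projection u).

Definition monotone_matching_decomposition A
    (F : {fset {fset {fset plane R}}}) : Prop :=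
  [/\ forall M, M \in F -> M != fset0 /\ monotone_matching A M,
      trivIfset F & fcover F = edges A].

End Geometry.

(* Model of computation: a structured real RAM.  A program owns finitely many
   unbounded memory banks of natural numbers and of real numbers (a scalar
   variable is cell 0 of a bank).  Natural numbers (addresses, counters) support
   +, truncated - and <; real numbers support +, -, *, / and <.  The only real
   constants are the natural numbers, and there is no rounding and no conversion
   from reals to integers.  Every operation, constant, memory access, test and
   output of a vertex costs one unit.  A program is a finite object depending
   neither on the input nor on its size. *)
Inductive iexp : Type :=
  | IConst of nat
  | IGet of nat & iexp          (* bank, address *)
  | IAdd of iexp & iexp
  | ISub of iexp & iexp.

Inductive rexp : Type :=
  | RConst of nat
  | RGet of nat & iexp          (* bank, address *)
  | RAdd of rexp & rexp
  | RSub of rexp & rexp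
  | RMul of rexp & rexp
  | RDiv of rexp & rexp.

Inductive bexp : Type :=
  | ILt of iexp & iexp
  | RLt of rexp & rexp
  | BNot of bexp.

Inductive cmd : Type :=
  | Skip
  | ISet of nat & iexp & iexp   (* bank, address, value *)
  | RSet of nat & iexp & rexp   (* bank, address, value *)
  | WriteVertex of iexp         (* appends a vertex index to the current path *)
  | EndPath                     (* closes the current path, starts a new one *)
  | Seq of cmd & cmd
  | If of bexp & cmd & cmd
  | While of bexp & cmd.

Fixpoint icost (e : iexp) : nat :=
  match e with
  | IConst _ => 1
  | IGet _ a => (icost a).+1
  | IAdd e1 e2 | ISub e1 e2 => (icost e1 + icost e2).+1
  end.

Fixpoint rcost (e : rexp) : nat :=
  match e with
  | RConst _ => 1
  | RGet _ a => (icost a).+1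
  | RAdd e1 e2 | RSub e1 e2 | RMul e1 e2 | RDiv e1 e2 =>
      (rcost e1 + rcost e2).+1
  end.

Fixpoint bcost (b : bexp) : nat :=
  match b with
  | ILt e1 e2 => (icost e1 + icost e2).+1
  | RLt e1 e2 => (rcost e1 + rcost e2).+1
  | BNot b1 => (bcost b1).+1
  end.

Section Machine.
Variable R : realType.

Record state : Type := State {
  imem : nat -> nat -> nat;     (* bank, address *)
  rmem : nat -> nat -> R;       (* bank, address *)
  current_path : seq nat;
  written_paths : seq (seq nat)
}.

Fixpoint ieval (st : state) (e : iexp) : nat :=
  match e with
  | IConst k => k
  | IGet b a => imem st b (ieval st a)
  | IAdd e1 e2 => (ieval st e1 + ieval st e2)%N
  | ISub e1 e2 => (ieval st e1 - ieval st e2)%N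
  end.

(* Division by zero returns zero, as in the library. *)
Fixpoint reval (st : state) (e : rexp) : R :=
  match e with
  | RConst k => k%:R
  | RGet b a => rmem st b (ieval st a)
  | RAdd e1 e2 => reval st e1 + reval st e2
  | RSub e1 e2 => reval st e1 - reval st e2
  | RMul e1 e2 => reval st e1 * reval st e2
  | RDiv e1 e2 => reval st e1 / reval st e2
  end.

Fixpoint beval (st : state) (b : bexp) : bool :=
  match b with
  | ILt e1 e2 => (ieval st e1 < ieval st e2)%N
  | RLt e1 e2 => reval st e1 < reval st e2
  | BNot b1 => ~~ beval st b1
  end.

Definition update (T : Type) (m : nat -> nat -> T) (b a : nat) (v : T) :
    nat -> nat -> T :=
  fun b' a' => if (b' == b) && (a' == a) then v else m b' a'.

Definition iset (st : state) (b a v : nat) : state :=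
  State (update (imem st) b a v) (rmem st) (current_path st) (written_paths st).

Definition rset (st : state) (b a : nat) (v : R) : state :=
  State (imem st) (update (rmem st) b a v) (current_path st) (written_paths st).

Definition write_vertex (st : state) (i : nat) : state :=
  State (imem st) (rmem st) (rcons (current_path st) i) (written_paths st).

Definition end_path (st : state) : state :=
  State (imem st) (rmem st) [::] (rcons (written_paths st) (current_path st)).

(* [exec c st t st']: started in [st], the program [c] halts in [st'] after [t]
   elementary operations. *)
Inductive exec : cmd -> state -> nat -> state -> Prop :=
  | ExecSkip st : exec Skip st 1 st
  | ExecISet st b a e :
      exec (ISet b a e) st (icost a + icost e).+1
        (iset st b (ieval st a) (ieval st e))
  | ExecRSet st b a e :
      exec (RSet b a e) st (icost a + rcost e).+1
        (rset st b (ieval st a) (reval st e))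
  | ExecWriteVertex st e :
      exec (WriteVertex e) st (icost e).+1 (write_vertex st (ieval st e))
  | ExecEndPath st : exec EndPath st 1 (end_path st)
  | ExecSeq c1 c2 st1 st2 st3 t1 t2 :
      exec c1 st1 t1 st2 -> exec c2 st2 t2 st3 ->
      exec (Seq c1 c2) st1 (t1 + t2) st3
  | ExecIfTrue b c1 c2 st st' t :
      beval st b -> exec c1 st t st' ->
      exec (If b c1 c2) st (bcost b + t).+1 st'
  | ExecIfFalse b c1 c2 st st' t :
      ~~ beval st b -> exec c2 st t st' ->
      exec (If b c1 c2) st (bcost b + t).+1 st'
  | ExecWhileFalse b c st :
      ~~ beval st b -> exec (While b c) st (bcost b).+1 st
  | ExecWhileTrue b c st1 st2 st3 t1 t2 :
      beval st1 b -> exec c st1 t1 st2 -> exec (While b c) st2 t2 st3 ->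
      exec (While b c) st1 (bcost b + t1 + t2).+1 st3.

(* The number of points is in cell 0 of natural-number bank 0, the first and
   second coordinates are in real banks 0 and 1; all other cells are zero. *)
Definition initial_state (pts : seq (plane R)) : state :=
  State
    (fun b a => if (b == 0%N) && (a == 0%N) then size pts else 0%N)
    (fun b a => if b == 0%N then (nth 0 pts a).1
                else if b == 1%N then (nth 0 pts a).2 else 0)
    [::] [::].

Definition valid_output (pts : seq (plane R)) (st : state) : bool :=
  all (all (fun i => (i < size pts)%N)) (written_paths st).

Definition output_paths (pts : seq (plane R)) (st : state) :
    seq (seq (plane R)) :=
  [seq [seq nth 0 pts i | i <- s] | s <- written_paths st].

End Machine.

(* Main.v *)
Require Import Defs.
From mathcomp Require Import all_boot all_order all_algebra finmap.
From mathcomp Require Import boolp classical_sets reals exp.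
From mathcomp Require Import zify lra ring.
Import Order.TTheory GRing.Theory Num.Theory.
Local Open Scope ring_scope.

Set Implicit Arguments.
Unset Strict Implicit.
Unset Printing Implicit Defensive.

(** Cut the square of half-side [D] around the first point into [K * K] cells,
    where [D] is the largest coordinate difference to that point.  Since [D] is
    at most the diameter, density bounds all distances from below by
    [D / (alpha * sqrt n)].  A side [K] of the order of [alpha * sqrt n] therefore
    separates any two points by at least two cells in one of the coordinates
    ([separated_cells]), and every cell holds at most one point.

    Consider an edge that leads from a lower cell [b] rows up and [a] columns
    aside, with [2 <= b] and [`|a| <= b]; the flat edges are of this kind after
    the coordinates are exchanged.  Fix [b], [a], the row of the lower cell and
    the residue modulo 10 of its column.  The edges with these data are almost
    translates of each other along a row.  The direction [(b, 5 - a)] is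
    [(b, - a)], orthogonal to the ideal edge, tilted a little towards the edge:
    enough for every one of these edges to ascend from its lower to its upper
    endpoint, and so little that ten columns further along the row the next lower
    endpoint lies beyond the last upper endpoint in that direction.  Visiting lower endpoint, upper
    endpoint, next lower endpoint and so on is thus a single monotone path
    ([swept_paths_monotone]) through all of these edges ([swept_paths_complete]).
    There are [O(K)] choices for each of [b], [a] and the row, which gives
    [O(K ^ 3)], that is [O(n ^ (3 / 2))], paths; each of them is found by a scan
    of one row, which gives [O(K ^ 4)], that is [O(n ^ 2)], operations.

    Once the points are entered in a table of cells, only cell indices matter,
    and five nested loops write the paths.  The program is verified in a
    small logic of total correctness with time budgets ([runs], [runs_for]); its
    output is computed as a pure list ([swept_paths], [runs_cover_program]), and
    the geometry is done on these lists.

    Every second edge of a monotone path is a monotone matching, as consecutive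
    edges overlap in one projected point only ([pair_up_trivIset]).  The two
    matchings of each path of the cover contain all edges, and edges can be
    dropped from a matching until each edge is in exactly one of them
    ([ex_disjoint_refinement]). *)

(** * A program logic with time budgets *)

Fixpoint ireads (e : iexp) : seq nat :=
  match e with
  | IConst _ => [::]
  | IGet b a => b :: ireads a
  | IAdd e1 e2 | ISub e1 e2 => ireads e1 ++ ireads e2
  end.

Fixpoint iwrites (c : cmd) : seq nat :=
  match c with
  | ISet b _ _ => [:: b]
  | Seq c1 c2 | If _ c1 c2 => iwrites c1 ++ iwrites c2
  | While _ c1 => iwrites c1
  | _ => [::]
  end.

Fixpoint rwrites (c : cmd) : seq nat :=
  match c with
  | RSet b _ _ => [:: b]
  | Seq c1 c2 | If _ c1 c2 => rwrites c1 ++ rwrites c2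
  | While _ c1 => rwrites c1
  | _ => [::]
  end.

Fixpoint silent (c : cmd) : bool :=
  match c with
  | WriteVertex _ | EndPath => false
  | Seq c1 c2 | If _ c1 c2 => silent c1 && silent c2
  | While _ c1 => silent c1
  | _ => true
  end.

Fixpoint loop_free (c : cmd) : bool :=
  match c with
  | Seq c1 c2 | If _ c1 c2 => loop_free c1 && loop_free c2
  | While _ _ => false
  | _ => true
  end.

(** An upper bound for the running time of loop-free programs: both branches of
    a test are charged. *)
Fixpoint cost (c : cmd) : nat :=
  match c with
  | ISet _ a e => (icost a + icost e).+1
  | RSet _ a e => (icost a + rcost e).+1
  | WriteVertex e => (icost e).+1
  | Seq c1 c2 => cost c1 + cost c2
  | If b c1 c2 => (bcost b + (cost c1 + cost c2)).+1
  | _ => 1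
  end%N.

(** Counting loop; [i] is the bank whose cell 0 holds the counter. *)
Definition For (i : nat) (bound : iexp) (body : cmd) : cmd :=
  Seq (ISet i (IConst 0) (IConst 0))
      (While (ILt (IGet i (IConst 0)) bound)
         (Seq body (ISet i (IConst 0) (IAdd (IGet i (IConst 0)) (IConst 1))))).

Section Logic.
Variable R : realType.
Implicit Types (st : state R) (c : cmd).

(** Execution is deterministic, so exhibiting one halting execution is total
    correctness. *)
Definition runs c st (t : nat) (Q : state R -> Prop) : Prop :=
  exists t' st', [/\ exec c st t' st', (t' <= t)%N & Q st'].

Lemma runs_mono c st t t' (Q Q' : state R -> Prop) :
  (t <= t')%N -> (forall st', Q st' -> Q' st') -> runs c st t Q -> runs c st t' Q'.
Proof.
move=> tt' QQ' [t1 [st1 [ex le1 Q1]]]; exists t1, st1; split=> //.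
  exact: leq_trans le1 tt'.
exact: QQ'.
Qed.

Lemma runs_seq c1 c2 st t1 t2 (P Q : state R -> Prop) :
  runs c1 st t1 P -> (forall st', P st' -> runs c2 st' t2 Q) ->
  runs (Seq c1 c2) st (t1 + t2) Q.
Proof.
move=> [t [st1 [ex1 le1 P1]]] /(_ _ P1)[t' [st2 [ex2 le2 Q2]]].
exists (t + t')%N, st2; split; [exact: ExecSeq ex1 ex2|exact: leq_add|by []].
Qed.

(** The state in which a loop-free program halts, as a function; loops are left
    out, so that symbolic execution is plain computation. *)
Fixpoint final c st : state R :=
  match c with
  | ISet b a e => iset st b (ieval st a) (ieval st e)
  | RSet b a e => rset st b (ieval st a) (reval st e)
  | WriteVertex e => write_vertex st (ieval st e)
  | EndPath => end_path st
  | Seq c1 c2 => final c2 (final c1 st)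
  | If b c1 c2 => if beval st b then final c1 st else final c2 st
  | _ => st
  end.

Lemma runs_loop_free c st x (Q : state R -> Prop) :
  (0 < x)%N -> loop_free c -> Q (final c st) -> runs c st (cost c * x) Q.
Proof.
move=> x0 lf Qf; apply: (@runs_mono _ _ (cost c) _ Q) => //; first exact: leq_pmulr.
suff [t ex le] : exists2 t, exec c st t (final c st) & (t <= cost c)%N.
  by exists t, (final c st).
elim: c st lf {Q Qf} => //=.
- by move=> st _; exists 1%N => //; exact: ExecSkip.
- by move=> b a e st _; eexists; first exact: ExecISet.
- by move=> b a e st _; eexists; first exact: ExecRSet.
- by move=> e st _; eexists; first exact: ExecWriteVertex.
- by move=> st _; exists 1%N => //; exact: ExecEndPath.
- move=> c1 IH1 c2 IH2 st /andP[lf1 lf2].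
  have [t1 ex1 le1] := IH1 st lf1; have [t2 ex2 le2] := IH2 (final c1 st) lf2.
  by exists (t1 + t2)%N; [exact: ExecSeq ex1 ex2|exact: leq_add].
- move=> b c1 IH1 c2 IH2 st /andP[lf1 lf2].
  case: ifPn => bst.
    have [t1 ex1 le1] := IH1 st lf1.
    exists (bcost b + t1).+1; first exact: ExecIfTrue.
    by rewrite ltnS leq_add2l (leq_trans le1) // leq_addr.
  have [t2 ex2 le2] := IH2 st lf2.
  exists (bcost b + t2).+1; first exact: ExecIfFalse.
  by rewrite ltnS leq_add2l (leq_trans le2) // leq_addl.
Qed.

(** What the text of [c] alone guarantees.  With it, an invariant only has to
    describe the banks that a loop changes. *)
Definition frame c st st' : Prop :=
  [/\ forall b, b \notin iwrites c -> imem st' b = imem st b,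
      forall b, b \notin rwrites c -> rmem st' b = rmem st b &
      silent c -> current_path st' = current_path st /\
                  written_paths st' = written_paths st].

Lemma frame_trans c st1 st2 st3 :
  frame c st1 st2 -> frame c st2 st3 -> frame c st1 st3.
Proof.
move=> [i1 r1 o1] [i2 r2 o2]; split=> [b nb|b nb|sc].
- by rewrite i2 ?i1.
- by rewrite r2 ?r1.
- by have [-> ->] := o2 sc; exact: o1.
Qed.

Lemma frame_sub c c' st st' :
  {subset iwrites c <= iwrites c'} -> {subset rwrites c <= rwrites c'} ->
  (silent c' -> silent c) -> frame c st st' -> frame c' st st'.
Proof.
move=> si sr ss [i1 r1 o1]; split=> [b nb|b nb|sc].
- by rewrite i1 //; apply: contra nb; exact: si.
- by rewrite r1 //; apply: contra nb; exact: sr.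
- exact/o1/ss.
Qed.

Lemma exec_frame c st t st' : exec c st t st' -> frame c st st'.
Proof.
have sub_catl (s1 s2 : seq nat) : {subset s1 <= s1 ++ s2}.
  by move=> x xs; rewrite mem_cat xs.
have sub_catr (s1 s2 : seq nat) : {subset s2 <= s1 ++ s2}.
  by move=> x xs; rewrite mem_cat xs orbT.
elim=> {c st t st'} //=.
- move=> st b a e; split=> //= b'; rewrite inE => /negPf nb.
  by apply/funext => a'; rewrite /update nb.
- move=> st b a e; split=> //= b'; rewrite inE => /negPf nb.
  by apply/funext => a'; rewrite /update nb.
- move=> c1 c2 st1 st2 st3 t1 t2 _ f1 _ f2.
  apply: (@frame_trans _ _ st2).
    by apply: frame_sub f1 => //=; case/andP.
  by apply: frame_sub f2 => //=; case/andP.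
- by move=> b c1 c2 st st' t _ _; apply: frame_sub => //=; case/andP.
- by move=> b c1 c2 st st' t _ _; apply: frame_sub => //=; case/andP.
- move=> b c st1 st2 st3 t1 t2 _ _ f1 _ f2.
  by apply: (@frame_trans _ _ st2) => //; apply: frame_sub f1.
Qed.

(** All budgets have the form [a * x], where [a] depends on the program text only
    and [x] counts iterations; consecutive programs share [x]. *)
Lemma runs_seq_scaled c1 c2 st a1 a2 x (P Q : state R -> Prop) :
  runs c1 st (a1 * x) P -> (forall st', P st' -> runs c2 st' (a2 * x) Q) ->
  runs (Seq c1 c2) st ((a1 + a2) * x) Q.
Proof. by rewrite mulnDl; exact: runs_seq. Qed.

Lemma runs_frame c st t (Q : state R -> Prop) :
  runs c st t Q -> runs c st t (fun st' => Q st' /\ frame c st st').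
Proof.
move=> [t' [st' [ex le Qst']]]; exists t', st'; split=> //; split=> //.
exact: exec_frame ex.
Qed.

Lemma ieval_frame c st st' e :
  frame c st st' -> ~~ has (mem (iwrites c)) (ireads e) ->
  ieval st' e = ieval st e.
Proof.
move=> [fi _ _]; elim: e => //=.
- by move=> b a IH; rewrite negb_or => /andP[/fi -> /IH ->].
- by move=> e1 IH1 e2 IH2; rewrite has_cat negb_or => /andP[/IH1 -> /IH2 ->].
- by move=> e1 IH1 e2 IH2; rewrite has_cat negb_or => /andP[/IH1 -> /IH2 ->].
Qed.

(** A loop multiplies [x] by the number of iterations and adds to the constant.
    Constants of nested loops are thus summed, never multiplied, and remain
    independent of the input.  One more iteration than the loop makes is charged:
    it pays for the initialisation and the last test.  The body may use
    everything that the loop does not write, through [frame]. *)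
Lemma runs_for (i : nat) bound body (I : nat -> state R -> Prop) (t1 x : nat) st0 :
  (0 < x)%N ->
  i \notin iwrites body -> ~~ has (mem (iwrites (For i bound body))) (ireads bound) ->
  (forall k v st, I k st -> I k (iset st i 0 v)) ->
  I 0%N st0 ->
  (forall k st, (k < ieval st0 bound)%N -> frame (For i bound body) st0 st ->
     imem st i 0%N = k -> I k st -> runs body st (t1 * x) (I k.+1)) ->
  runs (For i bound body) st0 ((t1 + (icost bound + 10)) * ((ieval st0 bound).+1 * x))
    (fun st => I (ieval st0 bound) st /\ frame (For i bound body) st0 st).
Proof.
move=> x0 ni nbound Ii I0 Ibody; set n := ieval st0 bound; set t := (t1 * x)%N.
apply: runs_frame.
apply: (@runs_mono _ _ (n.+1 * (t + (icost bound + 10))) _ (I n)) => //.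
  by rewrite mulnCA leq_mul // mulnDl leq_add // leq_pmulr.
have [tw [st' [exw lew Iw]]] : runs (While (ILt (IGet i (IConst 0)) bound)
         (Seq body (ISet i (IConst 0) (IAdd (IGet i (IConst 0)) (IConst 1)))))
    (iset st0 i 0 0) ((n - 0) * (t + (icost bound + 10)) + (icost bound + 4))
    (I n); last first.
  exists (3 + tw)%N, st'; split=> //; last by rewrite subn0 in lew; lia.
  by apply: ExecSeq exw; exact: ExecISet.
have fr0 : frame (For i bound body) st0 (iset st0 i 0 0).
  split=> //= b; rewrite inE negb_or => /andP[/negPf nb _].
  by apply/funext => a; rewrite /update nb.
suff loop j k st : (n - k)%N = j -> frame (For i bound body) st0 st ->
    I k st -> (k <= n)%N -> imem st i 0%N = k ->
    runs (While (ILt (IGet i (IConst 0)) bound)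
         (Seq body (ISet i (IConst 0) (IAdd (IGet i (IConst 0)) (IConst 1)))))
      st ((n - k) * (t + (icost bound + 10)) + (icost bound + 4)) (I n).
  apply: (loop n) => //; [by rewrite subn0|exact: Ii|].
  by rewrite /= /update !eqxx.
elim: j k st => [|j IH] k st ej fr Ik kn ik.
  have kn' : k = n by lia.
  exists (icost bound + 4)%N, st; split; [|exact: leq_addl|by rewrite -kn'].
  have -> : (icost bound + 4 = (bcost (ILt (IGet i (IConst 0)) bound)).+1)%N.
    by rewrite /=; lia.
  apply: ExecWhileFalse; rewrite /= ik (ieval_frame fr nbound) -/n; lia.
have kn' : (k < n)%N by lia.
have [tb [st1 [ex1 le1 I1]]] := Ibody k st kn' fr ik Ik.
have fr1 := exec_frame ex1.
have i1 : imem st1 i 0%N = k by case: fr1 => -> //; rewrite ik.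
set st2 := iset st1 i 0 k.+1.
have fr2 : frame (For i bound body) st0 st2.
  apply: (frame_trans fr); apply: (@frame_trans _ _ st1).
    apply: frame_sub fr1 => /= [b bb|b bb|/andP[] //].
      by rewrite inE mem_cat bb orbT.
    by rewrite mem_cat bb.
  split=> //= b; rewrite inE negb_or => /andP[/negPf nb _].
  by apply/funext => a; rewrite /update nb.
have [|||||tr [st3 [ex3 le3 I3]]] := IH k.+1 st2.
- by lia.
- exact: fr2.
- exact: Ii.
- exact: kn'.
- by rewrite /= /update !eqxx.
exists (bcost (ILt (IGet i (IConst 0)) bound) + (tb + 6) + tr).+1, st3; split=> //.
  apply: ExecWhileTrue ex3.
    by rewrite /= ik (ieval_frame fr nbound).
  apply: ExecSeq ex1 _.
  have -> : st2 = iset st1 i (ieval st1 (IConst 0))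
     (ieval st1 (IAdd (IGet i (IConst 0)) (IConst 1))).
    by rewrite /= i1 addn1.
  exact: ExecISet.
have ej' : (n - k.+1)%N = j by lia.
by move: le3; rewrite ej ej' mulSn /=; lia.
Qed.

End Logic.

(** * Lists indexed by loops *)

(** The list written by a loop whose iteration [k] appends [f k]. *)
Definition gather (T : Type) (n : nat) (f : nat -> seq T) : seq T :=
  flatten [seq f k | k <- iota 0 n].

Lemma gatherS (T : Type) n (f : nat -> seq T) : gather n.+1 f = gather n f ++ f n.
Proof. by rewrite /gather -addn1 iotaD map_cat flatten_cat /= cats0. Qed.

Lemma gatherP (T : eqType) n (f : nat -> seq T) (x : T) :
  reflect (exists2 k, (k < n)%N & x \in f k) (x \in gather n f).
Proof.
apply: (iffP flatten_mapP) => [[k]|[k kn xk]].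
  by rewrite mem_iota => kn xk; exists k.
by exists k => //; rewrite mem_iota.
Qed.

Lemma size_gather (T : Type) n m (f : nat -> seq T) :
  (forall k, (k < n)%N -> (size (f k) <= m)%N) -> (size (gather n f) <= n * m)%N.
Proof.
elim: n => [//|n IH] fm; rewrite gatherS size_cat mulSnr leq_add ?fm //.
by apply: IH => k kn; apply: fm; apply: ltnW.
Qed.

Lemma gather_cat (T : Type) n k (f : nat -> seq T) : (k < n)%N ->
  exists s1 s2, gather n f = s1 ++ f k ++ s2.
Proof.
elim: n => [//|n IH]; rewrite gatherS ltnS leq_eqVlt => /orP[/eqP->|/IH[s1 [s2 ->]]].
  by exists (gather n f), [::]; rewrite cats0.
by exists s1, (s2 ++ f n); rewrite !catA.
Qed.

(** The value left in a variable by a loop that overwrites it with each index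
    satisfying [P]: the largest such index below [n], or 0. *)
Definition last_such (P : pred nat) (n : nat) : nat :=
  last 0%N [seq k <- iota 0 n | P k].

Lemma last_suchS (P : pred nat) n : last_such P n.+1 = if P n then n else last_such P n.
Proof.
rewrite /last_such -addn1 iotaD filter_cat /= add0n.
by case: (P n); rewrite ?cats1 ?last_rcons ?cats0.
Qed.

Lemma last_such_le (P : pred nat) n : (last_such P n <= n)%N.
Proof.
elim: n => [//|n IH]; rewrite last_suchS.
by case: ifP => _; [exact: leqnSn|exact: leqW].
Qed.

Lemma last_suchP (P : pred nat) n : P 0%N -> (0 < n)%N ->
  [/\ (last_such P n < n)%N, P (last_such P n) &
      forall k, (k < n)%N -> P k -> (k <= last_such P n)%N].
Proof.
move=> P0; elim: n => [//|[|n] IH] _; rewrite last_suchS.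
  by rewrite P0; split=> // -[].
case: ifPn => Pn; first by split=> // k; rewrite ltnS.
have [lt_l Pl max_l] := IH isT; split=> // [|k].
  exact: ltnW.
rewrite ltnS leq_eqVlt => /orP[/eqP-> Pk|]; last exact: max_l.
by rewrite Pk in Pn.
Qed.

(** * The program *)

(** Memory layout.  Among the banks of natural numbers, [bN] is the number of
    points, [bS] its square root rounded up, [bSq] the square of [bS]; [bK] is the
    side of the grid and [bL] a tenth of it; [bMul] lists the multiples of the row
    width [bW]; [bCx], [bCy] are the cell of the current point; [bRows] and [bCols]
    are the grid stored row by row and column by column; [bFlag] tells whether the
    current path has a vertex.  The banks named with [i] are loop counters.  Among
    the banks of reals, [rX] and [rY] are the coordinates of the points, [rD] is
    the radius of the grid and [rKr] lists the natural numbers as reals. *)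
Notation bN := 0%N (only parsing).
Notation bS := 1%N (only parsing).
Notation bSq := 2%N (only parsing).
Notation bK := 3%N (only parsing).
Notation bL := 4%N (only parsing).
Notation bW := 5%N (only parsing).
Notation bMul := 6%N (only parsing).
Notation bCx := 7%N (only parsing).
Notation bCy := 8%N (only parsing).
Notation bRows := 9%N (only parsing).
Notation bCols := 10%N (only parsing).
Notation bFlag := 11%N (only parsing).
Notation iI := 12%N (only parsing).
Notation iK := 13%N (only parsing).
Notation iY := 14%N (only parsing).
Notation iB := 15%N (only parsing).
Notation iC := 16%N (only parsing).
Notation iR := 17%N (only parsing).
Notation iJ := 18%N (only parsing).
Notation rX := 0%N (only parsing).
Notation rY := 1%N (only parsing).
Notation rD := 2%N (only parsing).
Notation rKr := 3%N (only parsing).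

Notation "'`' b" := (IGet b (IConst 0)) (at level 2, format "'`' b").

(** The machine adds but does not multiply natural numbers; a constant factor is
    unrolled in the program text. *)
Fixpoint itimes (k : nat) (e : iexp) : iexp :=
  if k is k'.+1 then IAdd e (itimes k' e) else IConst 0.

Arguments itimes : simpl never.

Definition ceil_sqrt : cmd :=
  For iI `bN
    (If (ILt `bSq `bN)
       (Seq (ISet bSq (IConst 0) (IAdd `bSq (IAdd `bS (IAdd `bS (IConst 1)))))
            (ISet bS (IConst 0) (IAdd `bS (IConst 1))))
       Skip).

Definition grid_size (m : nat) : cmd :=
  Seq (ISet bL (IConst 0) (itimes m `bS))
  (Seq (ISet bK (IConst 0) (itimes 10 `bL))
       (ISet bW (IConst 0) (itimes 3 `bK))).

(** Products of indices with the row width, needed to address the tables, are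
    looked up; so are the natural numbers as reals, which the machine cannot
    convert. *)
Definition multiples : cmd :=
  For iI `bK
    (Seq (ISet bMul (IAdd `iI (IConst 1)) (IAdd (IGet bMul `iI) `bW))
         (RSet rKr (IAdd `iI (IConst 1)) (RAdd (RGet rKr `iI) (RConst 1)))).

Definition raise_radius (e : rexp) : cmd :=
  If (RLt (RGet rD (IConst 0)) e) (RSet rD (IConst 0) e) Skip.

Definition raise_radius_by (d : nat) : cmd :=
  Seq (raise_radius (RSub (RGet d `iI) (RGet d (IConst 0))))
      (raise_radius (RSub (RGet d (IConst 0)) (RGet d `iI))).

Definition radius : cmd :=
  For iI `bN (Seq (raise_radius_by rX) (raise_radius_by rY)).

(** The cell is the last [k] whose left border [2 * D * k / K] does not exceed the
    coordinate measured from the left side of the square.  Comparing after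
    multiplication by [K] avoids the division. *)
Definition locate (d dest : nat) : cmd :=
  Seq (ISet dest (IConst 0) (IConst 0))
    (For iK `bK
       (If (RLt (RMul (RGet rKr `bK)
                      (RAdd (RSub (RGet d `iI) (RGet d (IConst 0)))
                            (RGet rD (IConst 0))))
                (RMul (RMul (RConst 2) (RGet rD (IConst 0))) (RGet rKr `iK)))
          Skip (ISet dest (IConst 0) `iK))).

(** Point [i] is entered as [i + 1], because 0 stands for an empty cell.  A row has
    width [3 * K] with its cells in the middle third, so that a column shifted by
    at most [K] to either side stays in the row. *)
Definition enter (g row col : nat) : cmd :=
  ISet g (IAdd (IGet bMul `row) (IAdd `bK `col)) (IAdd `iI (IConst 1)).

Definition fill_tables : cmd :=
  For iI `bN
    (Seq (locate rX bCx)
    (Seq (locate rY bCy)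
    (Seq (enter bRows bCy bCx)
         (enter bCols bCx bCy)))).

(** The number of rows between the two ends of an edge: the counter starts at 0,
    but only gaps of at least 2 are swept. *)
Definition gap : iexp := IAdd `iB (IConst 2).

Definition column : iexp := IAdd `iR (itimes 10 `iJ).

Definition lower_entry (g : nat) : iexp :=
  IGet g (IAdd (IGet bMul `iY) (IAdd `bK column)).

(** The counter [iC] is the column shift plus [gap], hence nonnegative. *)
Definition upper_entry (g : nat) : iexp :=
  IGet g (IAdd (IAdd (IGet bMul `iY) (IGet bMul gap))
               (ISub (IAdd (IAdd `bK column) `iC) gap)).

Definition write_edge (g : nat) : cmd :=
  If (ILt (IConst 0) (lower_entry g))
    (If (ILt (IConst 0) (upper_entry g))
       (Seq (WriteVertex (ISub (lower_entry g) (IConst 1)))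
       (Seq (WriteVertex (ISub (upper_entry g) (IConst 1)))
            (ISet bFlag (IConst 0) (IConst 1))))
       Skip)
    Skip.

Definition close_path : cmd :=
  If (ILt (IConst 0) `bFlag) (Seq EndPath (ISet bFlag (IConst 0) (IConst 0))) Skip.

Definition write_path (g : nat) : cmd :=
  Seq (For iJ `bL (write_edge g)) close_path.

Definition sweep (g : nat) : cmd :=
  For iY `bK
    (For iB (ISub `bK (IConst 2))
      (For iC (IAdd gap (IAdd gap (IConst 1)))
        (For iR (IConst 10) (write_path g)))).

Definition cover_program (m : nat) : cmd :=
  Seq ceil_sqrt (Seq (grid_size m) (Seq multiples (Seq radius
    (Seq fill_tables (Seq (sweep bRows) (sweep bCols)))))).

(** * What the program computes *)

(** Pure counterparts of the entries, edges and paths of a sweep of table [G]. *)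
Section Output.
Variables (K L : nat) (G : nat -> nat).

Definition lower_cell (y x : nat) : nat := G (y * (3 * K) + (K + x)).

Definition upper_cell (y b c x : nat) : nat :=
  G (y * (3 * K) + (b.+2 * (3 * K)) + (K + x + c - b.+2)).

Definition edge_at (y b c x : nat) : seq nat :=
  if (0 < lower_cell y x)%N && (0 < upper_cell y b c x)%N
  then [:: (lower_cell y x).-1; (upper_cell y b c x).-1] else [::].

Definition swept_path (y b c r : nat) : seq nat :=
  gather L (fun j => edge_at y b c (r + 10 * j)).

Definition keep_nonempty (s : seq nat) : seq (seq nat) :=
  if s == [::] then [::] else [:: s].

Definition swept_paths : seq (seq nat) :=
  gather K (fun y => gather (K - 2) (fun b => gather (b.+2 + (b.+2 + 1))
    (fun c => gather 10 (fun r => keep_nonempty (swept_path y b c r))))).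

End Output.

Definition is_radius (R : realType) (X Y : nat -> R) (n : nat) (D : R) : Prop :=
  (forall i, (i < n)%N -> `|X i - X 0%N| <= D /\ `|Y i - Y 0%N| <= D) /\
  (D = 0 \/ exists2 i, (i < n)%N & D = `|X i - X 0%N| \/ D = `|Y i - Y 0%N|).

Definition cell_of (R : realType) (K : nat) (D v : R) : nat :=
  last_such (fun k => 2 * D * k%:R <= K%:R * (v + D)) K.

(** [G] after the points below [n] are entered at their addresses.  Of several
    points with the same address, one survives. *)
Definition tabled (G addr : nat -> nat) (n : nat) : Prop :=
  forall a, (exists i, [/\ (i < n)%N, a = addr i & G a = i.+1]) \/
            (G a = 0%N /\ forall i, (i < n)%N -> addr i <> a).

Lemma tabled_enter G addr n : tabled G addr n ->
  tabled (fun a => if a == addr n then n.+1 else G a) addr n.+1.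
Proof.
move=> tG a; case: eqP => [->|ne]; first by left; exists n.
case: (tG a) => [[i [lt_i -> Ga]]|[Ga out]].
  by left; exists i; rewrite ltnS ltnW.
right; split=> // i; rewrite ltnS leq_eqVlt => /orP[/eqP->|/out //].
by move=> /esym.
Qed.

Section Correctness.
Variable R : realType.
Implicit Types st : state R.

Lemma ieval_itimes st k e : ieval st (itimes k e) = (k * ieval st e)%N.
Proof. by elim: k => [//|k IH]; rewrite [LHS]/= -/(itimes k e) IH mulSn. Qed.

Lemma ieval_lower_entry st g : ieval st (lower_entry g) =
  imem st g (imem st bMul (imem st iY 0) +
             (imem st bK 0 + (imem st iR 0 + 10 * imem st iJ 0))).
Proof. by rewrite -[(10 * _)%N](ieval_itimes st 10 `iJ). Qed.

Lemma ieval_upper_entry st g : ieval st (upper_entry g) =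
  imem st g (imem st bMul (imem st iY 0) + imem st bMul (imem st iB 0).+2 +
             (imem st bK 0 + (imem st iR 0 + 10 * imem st iJ 0) + imem st iC 0
              - (imem st iB 0).+2)).
Proof. by rewrite -[(imem st iB 0).+2]addn2 -[(10 * _)%N](ieval_itimes st 10 `iJ). Qed.

Lemma ieval_write_vertex st v e : ieval (write_vertex st v) e = ieval st e.
Proof.
by elim: e => //= [b a ->|e1 -> e2 ->|e1 -> e2 ->].
Qed.

Lemma runs_ceil_sqrt : exists c, forall st,
  imem st bS 0 = 0%N -> imem st bSq 0 = 0%N ->
  let n := imem st bN 0 in
  runs ceil_sqrt st (c * n.+1)
    (fun st' => [/\ (n <= imem st' bS 0 ^ 2)%N, (imem st' bS 0 ^ 2 <= 4 * n)%N &
                 frame ceil_sqrt st st']).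
Proof.
eexists=> st s0 sq0 n; rewrite -[n.+1]muln1.
(* The last disjunct says that the root never grows beyond need: it gives the
   upper bound, from (s - 1)^2 < n. *)
pose I k st' := let s := imem st' bS 0 in
  [/\ imem st' bSq 0 = (s ^ 2)%N, (n <= s ^ 2)%N \/ s = k &
      s = 0%N \/ (s.-1 ^ 2 < n)%N].
apply: (@runs_mono _ _ _ _ _ (fun st' => I n st' /\ frame ceil_sqrt st st') _ (leqnn _)).
  move=> st' [[_ Hk Hs] fr]; split=> //; rewrite -/n in Hk *.
    by case: Hk => [//|->]; nia.
  by case: Hs => [->//|]; case: (imem st' bS 0) => [//|s] /=; nia.
apply: (@runs_for _ _ _ _ I) => //.
  by rewrite /I s0 sq0; split=> //; [right|left].
move=> k st' kn [fi _ _] _ [sq Hk Hs]; apply: runs_loop_free => //=.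
have {}fi : imem st' bN 0 = n by rewrite fi.
rewrite fi sq; case: ltnP => [lt|ge] /=; last by split=> //; left.
rewrite /I /= /update /=; split.
- by rewrite -!mulnn; nia.
- by right; lia.
- by right; rewrite addn1.
Qed.

Lemma runs_grid_size m : exists c, forall st,
  let s := imem st bS 0 in
  runs (grid_size m) st (c * 1)
    (fun st' => [/\ imem st' bL 0 = (m * s)%N, imem st' bK 0 = (10 * (m * s))%N,
       imem st' bW 0 = (3 * (10 * (m * s)))%N & frame (grid_size m) st st']).
Proof.
eexists=> st s.
apply: (@runs_mono _ _ _ _ _ (fun st' =>
    [/\ imem st' bL 0 = (m * s)%N, imem st' bK 0 = (10 * (m * s))%N &
        imem st' bW 0 = (3 * (10 * (m * s)))%N] /\
    frame (grid_size m) st st') _ (leqnn _)).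
  by move=> st' [[]].
apply: runs_frame; apply: runs_loop_free => //.
by rewrite /update /= !ieval_itimes.
Qed.

Lemma runs_multiples : exists c, forall st,
  imem st bMul 0 = 0%N -> rmem st rKr 0%N = 0 ->
  let K := imem st bK 0 in
  runs multiples st (c * K.+1)
    (fun st' => (forall i, (i <= K)%N -> imem st' bMul i = (i * imem st bW 0)%N /\
                    rmem st' rKr i = i%:R) /\
                frame multiples st st').
Proof.
eexists=> st mul0 kr0 K; rewrite -[K.+1]muln1.
apply: (@runs_for _ _ _ _ (fun k st' => forall i, (i <= k)%N ->
   imem st' bMul i = (i * imem st bW 0)%N /\ rmem st' rKr i = i%:R)) => //.
  by case=> // _; rewrite mul0 kr0.
move=> k st' kn [fi _ _] ik H; apply: runs_loop_free => //= i.
have fW : imem st' bW = imem st bW by rewrite fi.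
have [Hm Hr] := H k (leqnn k).
rewrite /update /= ik addn1 leq_eqVlt ltnS => /orP[/eqP->|lt_ik].
  by rewrite eqxx fW Hm Hr mulSn addnC natr1.
by rewrite ltn_eqF ?ltnS //; exact: H.
Qed.

Lemma final_raise_radius e st :
  let st' := final (raise_radius e) st in
  [/\ imem st' = imem st, forall b, b != rD -> rmem st' b = rmem st b &
      rmem st' rD 0%N = Num.max (rmem st rD 0%N) (reval st e)].
Proof.
rewrite /= /Num.max; case: ifP => //= _; split=> // b /negPf nb.
by apply/funext => a; rewrite /update nb.
Qed.

Lemma final_raise_radius_by d st : d \in [:: rX; rY] ->
  let st' := final (raise_radius_by d) st in
  let i := imem st iI 0%N in
  [/\ imem st' = imem st, forall b, b != rD -> rmem st' b = rmem st b &
      rmem st' rD 0%N = Num.max (rmem st rD 0%N) `|rmem st d i - rmem st d 0%N|].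
Proof.
move=> d01; have d2 : d != rD by case/or3P: d01 => // /eqP->.
move=> st' i; pose e1 := RSub (RGet d `iI) (RGet d (IConst 0)).
pose e2 := RSub (RGet d (IConst 0)) (RGet d `iI).
have [i1 r1 D1] := final_raise_radius e1 st.
have [i2 r2 D2] := final_raise_radius e2 (final (raise_radius e1) st).
have -> : st' = final (raise_radius e2) (final (raise_radius e1) st) by [].
split=> [|b nb|]; first by rewrite i2 i1.
  by rewrite r2 ?r1.
rewrite D2 D1 {1}/e2 /reval r1 // -/(ieval _ _) /ieval i1 -maxA; congr Num.max.
rewrite /Num.max; set a := rmem st d _; set b := rmem st d 0.
by case: ifP; case: (ler0P (a - b)) => h3; lra.
Qed.

Lemma runs_radius : exists c, forall st, rmem st rD 0%N = 0 ->
  let n := imem st bN 0 in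
  runs radius st (c * n.+1)
    (fun st' => is_radius (rmem st rX) (rmem st rY) n (rmem st' rD 0%N) /\
                frame radius st st').
Proof.
eexists=> st D0 n; rewrite -[n.+1]muln1.
pose I k st' := is_radius (rmem st rX) (rmem st rY) k (rmem st' rD 0%N).
apply: (@runs_for _ _ _ _ I) => //; first by split=> //; left.
move=> k st' kn [_ fr _] ik H; apply: runs_loop_free => //; rewrite /I.
have [i1 r1 D1] := final_raise_radius_by st' (isT : rX \in [:: rX; rY]).
have [i2 r2 D2] := final_raise_radius_by (final (raise_radius_by rX) st')
  (isT : rY \in [:: rX; rY]).
rewrite -[final _ _]/(final (raise_radius_by rY) (final (raise_radius_by rX) st')).
rewrite D2 D1 i1 !r1 // ik (fr rX) // (fr rY) //.
case: H; set D := rmem st' _ _ => bnd att.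
split=> [i|].
  rewrite ltnS leq_eqVlt !le_max => /orP[/eqP->|/bnd[-> ->//]].
  by rewrite !lexx !orbT.
rewrite /Num.max; case: ifP => _; first by right; exists k => //; right.
case: ifP => _; first by right; exists k => //; left.
case: att => [->|[i ik' ?]]; first by left.
by right; exists i => //; exact: ltnW.
Qed.

Lemma runs_locate d dest : dest \in [:: bCx; bCy] -> exists c, forall st,
  let K := imem st bK 0 in
  (forall k, (k <= K)%N -> rmem st rKr k = k%:R) ->
  runs (locate d dest) st (c * K.+1)
    (fun st' => imem st' dest 0 =
       cell_of K (rmem st rD 0%N) (rmem st d (imem st iI 0%N) - rmem st d 0%N) /\
       frame (locate d dest) st st').
Proof.
move=> dest78; have nK : dest != iK by move: dest78; case/or3P => // /eqP->.
have nb : dest \notin [:: bK; iI] by move: dest78; case/or3P => // /eqP->.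
eexists=> st K kr; apply: runs_frame; apply: runs_seq_scaled.
  apply: (@runs_loop_free _ _ _ _ (fun st' => st' = iset st dest 0 0)) => //.
move=> _ ->; set st1 := iset _ _ _ _.
have stK : imem st1 bK = imem st bK.
  by apply/funext => a; rewrite /= /update; case: eqP nb => [<-|].
have stI : imem st1 iI = imem st iI.
  by apply/funext => a; rewrite /= /update; case: eqP nb => [<-|].
set v := rmem st d _ - _.
pose P k := 2 * rmem st rD 0%N * k%:R <= K%:R * (v + rmem st rD 0%N).
have eK : ieval st1 `bK = K by rewrite -[LHS]/(imem st1 bK 0%N) stK.
pose I k (st' : state R) := imem st' dest 0 = last_such P k.
apply: (@runs_mono _ _ _ _ _ (fun st' =>
    I (ieval st1 `bK) st' /\ frame (For iK `bK _) st1 st') _ (leqnn _)).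
  by move=> st' [+ _]; rewrite eK.
rewrite -[K.+1]muln1 -eK.
apply: (@runs_for _ _ _ _ I) => //.
- by rewrite /= !inE; move: dest78; rewrite !inE => /orP[]/eqP->.
- by rewrite /= !inE; move: dest78; rewrite !inE => /orP[]/eqP->.
- by move=> k e st'; rewrite /I /= /update (negPf nK).
- by rewrite /I /= /update !eqxx.
move=> k st'; rewrite eK => kn [fi fr _] ik H.
apply: runs_loop_free => //; rewrite /I last_suchS /P [final _ _]/=.
have fd : imem st' bK = imem st bK.
  by rewrite fi ?stK //= !inE; move: dest78; rewrite !inE => /orP[]/eqP->.
have fI : imem st' iI = imem st iI.
  by rewrite fi ?stI //= !inE; move: dest78; rewrite !inE => /orP[]/eqP->.
rewrite !fr // ik fd fI -/K !kr //; last exact: ltnW.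
rewrite -/v leNgt; case: ifP => _ //=.
by rewrite /update !eqxx.
Qed.

Lemma runs_fill_tables : exists c, forall st,
  let n := imem st bN 0 in let K := imem st bK 0 in
  (forall k, (k <= K)%N -> imem st bMul k = (k * (3 * K))%N /\ rmem st rKr k = k%:R) ->
  (forall a, imem st bRows a = 0%N) -> (forall a, imem st bCols a = 0%N) ->
  let cell d i := cell_of K (rmem st rD 0%N) (rmem st d i - rmem st d 0%N) in
  runs fill_tables st (c * (n.+1 * K.+1))
    (fun st' =>
      [/\ tabled (imem st' bRows) (fun i => cell rY i * (3 * K) + (K + cell rX i))%N n,
          tabled (imem st' bCols) (fun i => cell rX i * (3 * K) + (K + cell rY i))%N n &
          frame fill_tables st st']).
Proof.
have [cX runX] := @runs_locate rX bCx isT.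
have [cY runY] := @runs_locate rY bCy isT.
eexists=> st n K arith rows0 cols0 cell.
pose I k (st' : state R) :=
  tabled (imem st' bRows) (fun i => cell rY i * (3 * K) + (K + cell rX i))%N k /\
  tabled (imem st' bCols) (fun i => cell rX i * (3 * K) + (K + cell rY i))%N k.
apply: (@runs_mono _ _ _ _ _ (fun st' => I n st' /\ frame fill_tables st st') _ (leqnn _)).
  by move=> st' [[]].
apply: (@runs_for _ _ _ _ I) => //.
  by split=> a; right; split.
move=> k st1 kn [fi1 fr1 _] ik [HR HC].
have K1 : imem st1 bK 0 = K by rewrite fi1.
have run1 := runX st1; rewrite K1 in run1.
apply: runs_seq_scaled; first by apply: run1 => j jK; rewrite fr1 //; case: (arith j jK).
move=> st2 [ex2 [fi2 fr2 _]].
have K2 : imem st2 bK 0 = K by rewrite fi2.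
have run2 := runY st2; rewrite K2 in run2.
apply: runs_seq_scaled.
  by apply: run2 => j jK; rewrite fr2 // fr1 //; case: (arith j jK).
move=> st3 [ey3 [fi3 fr3 _]]; apply: runs_loop_free => //.
have ex : imem st3 bCx 0 = cell rX k.
  by rewrite fi3 // ex2 !fr1 // ik.
have ey : imem st3 bCy 0 = cell rY k.
  by rewrite ey3 !fr2 // !fr1 // fi2 // ik.
have mulE j : (j <= K)%N -> imem st3 bMul j = (j * (3 * K))%N.
  by move=> jK; rewrite fi3 // fi2 // fi1 //; case: (arith j jK).
have cellK d i : (cell d i <= K)%N by exact: last_such_le.
have ik3 : imem st3 iI 0 = k by rewrite fi3 // fi2.
have K3 : imem st3 bK 0 = K by rewrite fi3.
have rows3 : imem st3 bRows = imem st1 bRows by rewrite fi3 // fi2.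
have cols3 : imem st3 bCols = imem st1 bCols by rewrite fi3 // fi2.
move/tabled_enter: HR => HR; move/tabled_enter: HC => HC.
rewrite -rows3 in HR; rewrite -cols3 in HC.
by rewrite /I /= /update /= ex ey K3 ik3 !mulE // addn1; split.
Qed.

(** Between paths, nothing is pending; this is what lets the outputs of
    successive iterations be concatenated. *)
Definition ready st : Prop := imem st bFlag 0 = 0%N /\ current_path st = [::].

Definition emits c st t (out : seq (seq nat)) : Prop :=
  runs c st t (fun st' => [/\ ready st', written_paths st' = written_paths st ++ out &
                              frame c st st']).

Lemma emits_le c st t t' out out' : (t <= t')%N -> out = out' ->
  emits c st t out -> emits c st t' out'.
Proof. by move=> tt' <-; exact: runs_mono. Qed.

Lemma emits_for (i : nat) bound body (f : nat -> seq (seq nat)) t1 x st0 :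
  (0 < x)%N -> i \notin bFlag :: iwrites body ->
  ~~ has (mem (iwrites (For i bound body))) (ireads bound) -> ready st0 ->
  (forall k st, (k < ieval st0 bound)%N -> frame (For i bound body) st0 st ->
     imem st i 0%N = k -> ready st -> emits body st (t1 * x) (f k)) ->
  emits (For i bound body) st0 ((t1 + (icost bound + 10)) * ((ieval st0 bound).+1 * x))
    (gather (ieval st0 bound) f).
Proof.
rewrite inE negb_or => x0 /andP[ni11 ni] nb st0r Hbody; rewrite /emits.
pose I k st := ready st /\ written_paths st = written_paths st0 ++ gather k f.
apply: (@runs_mono _ _ _ _ _ (fun st' =>
    I (ieval st0 bound) st' /\ frame (For i bound body) st0 st') _ (leqnn _)).
  by move=> st' [[]].
apply: (@runs_for _ _ _ _ I) => //.
- move=> k v st [[fl cur] W]; split=> //; split=> //=.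
  by rewrite /update eq_sym (negPf ni11).
- by split=> //; rewrite cats0.
move=> k st kn fr ik [rdy W].
apply: runs_mono (leqnn _) _ (Hbody k st kn fr ik rdy) => st' [rdy' W' _].
by split=> //; rewrite W' W gatherS catA.
Qed.

Lemma emits_write_path g : g \in [:: bRows; bCols] -> exists c, forall st,
  let K := imem st bK 0 in let L := imem st bL 0 in
  let y := imem st iY 0 in let b := imem st iB 0 in
  (forall k, (k <= K)%N -> imem st bMul k = (k * (3 * K))%N) ->
  (y <= K)%N -> (b.+2 <= K)%N -> ready st ->
  emits (write_path g) st (c * L.+1)
    (keep_nonempty (swept_path K L (imem st g) y b (imem st iC 0) (imem st iR 0))).
Proof.
move=> gg; eexists=> st K L y b mulE yK bK [flag0 cur0]; rewrite /emits.
pose edge j := edge_at K (imem st g) y b (imem st iC 0) (imem st iR 0 + 10 * j).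
pose I k (st' : state R) :=
  [/\ current_path st' = gather k edge, written_paths st' = written_paths st &
      imem st' bFlag 0 = (gather k edge != [::])].
apply: (@runs_mono _ _ _ _ _ (fun st' => (ready st' /\ written_paths st' = written_paths st ++
   keep_nonempty (swept_path K L (imem st g) y b (imem st iC 0) (imem st iR 0))) /\
   frame (write_path g) st st') _ (leqnn _)).
  by move=> st' [[]].
apply: runs_frame; apply: runs_seq_scaled.
  rewrite -[L.+1]muln1; apply: (@runs_for _ _ _ _ I) => //.
  move=> k st' kn [fi fr _] ik [Hc Hw Hf]; apply: runs_loop_free => //.
  have fig : imem st' g = imem st g.
    by rewrite fi //=; move: gg; rewrite !inE => /orP[]/eqP->.
  have lowE : ieval st' (lower_entry g) =
      lower_cell K (imem st g) y (imem st iR 0 + 10 * k).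
    rewrite ieval_lower_entry fig ik.
    by rewrite !fi // mulE.
  have upE : ieval st' (upper_entry g) =
      upper_cell K (imem st g) y b (imem st iC 0) (imem st iR 0 + 10 * k).
    rewrite ieval_upper_entry fig ik.
    by rewrite !fi // !mulE.
  rewrite /I gatherS /edge /edge_at -lowE -upE.
  set low := lower_entry g; set up := upper_entry g.
  have -> : final (write_edge g) st' =
      if (0 < ieval st' low)%N then if (0 < ieval st' up)%N then
        iset (write_vertex (write_vertex st' (ieval st' low - 1))
           (ieval (write_vertex st' (ieval st' low - 1)) up - 1)) bFlag 0 1
      else st' else st' by [].
  rewrite ieval_write_vertex; move: (ieval st' low) (ieval st' up) => l u.
  case: ifP => /= _; last by rewrite cats0.
  case: ifP => /= _; last by rewrite cats0.
  rewrite Hc Hw /update /= -!subn1 -!cats1 -catA.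
  by split=> //; case: (gather k edge).
move=> st' [[]].
rewrite -[gather _ edge]/(swept_path K L (imem st g) y b (imem st iC 0) (imem st iR 0)).
move=> Hc Hw Hf _; apply: runs_loop_free => //; rewrite /keep_nonempty.
rewrite [final _ _]/=; case: (swept_path _ _ _ _ _ _ _) Hc Hf => [|v s] /= Hc Hf.
  by rewrite Hf /ready Hc Hw cats0.
by rewrite Hf /ready /= /update /= Hw Hc cats1.
Qed.

Lemma emits_sweep g : g \in [:: bRows; bCols] -> exists c, forall st,
  let K := imem st bK 0 in let L := imem st bL 0 in
  (forall k, (k <= K)%N -> imem st bMul k = (k * (3 * K))%N) -> (L <= K)%N -> ready st ->
  emits (sweep g) st (c * K.+1 ^ 4) (swept_paths K L (imem st g)).
Proof.
move=> gg; have [c0 run0] := emits_write_path gg.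
have gW (bs : seq nat) : all (fun b => b \notin bs) [:: bRows; bCols] -> g \notin bs.
  by case/and3P=> n9 n10 _; move: gg; rewrite !inE => /orP[]/eqP->.
eexists=> st K L mulE LK rdy.
pose path y b c r := keep_nonempty (swept_path K L (imem st g) y b c r).
apply: emits_le; last first.
- apply: (@emits_for iY `bK _ (fun y => gather (K - 2) (fun b =>
    gather (b.+2 + (b.+2 + 1)) (fun c => gather 10 (path y b c))))
    _ (K.+1 * (K.+1 * (22 * K.+1)))) => //.
  move=> y st1 yK fr1 iy rdy1.
  have K1 : imem st1 bK 0 = K by case: fr1 => ->.
  have e1 : ieval st1 (ISub `bK (IConst 2)) = (K - 2)%N by rewrite /= K1.
  apply: emits_le; last first.
  + apply: (@emits_for iB _ _ (fun b =>
      gather (b.+2 + (b.+2 + 1)) (fun c => gather 10 (path y b c)))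
      _ (K.+1 * (22 * K.+1))) => //.
    move=> b st2; rewrite e1 => ltb fr2 ib rdy2.
    have e2 : ieval st2 (IAdd gap (IAdd gap (IConst 1))) = (b.+2 + (b.+2 + 1))%N.
      by rewrite /= ib addn2.
    apply: emits_le; last first.
    * apply: (@emits_for iC _ _ (fun c => gather 10 (path y b c)) _ (11 * K.+1)) => //.
      move=> c st3 cb fr3 ic rdy3.
      apply: emits_le; last first.
      - apply: (@emits_for iR _ _ (path y b c) _ K.+1) => //.
        move=> r st4 r10 fr4 ir rdy4.
        have st4E bk : bk \notin [:: iY; iB; iC; iR; iJ; bFlag] ->
            imem st4 bk = imem st bk.
          move=> nbk; have nin s : all (mem [:: iY; iB; iC; iR; iJ; bFlag]) s -> bk \notin s.
            by move=> /allP sub; apply: contra nbk => /sub.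
          case: fr4 => -> //; last exact: nin.
          case: fr3 => -> //; last exact: nin.
          case: fr2 => -> //; last exact: nin.
          by case: fr1 => -> //; exact: nin.
        have K4 : imem st4 bK 0 = K by rewrite st4E.
        have L4 : imem st4 bL 0 = L by rewrite st4E.
        have m4 : imem st4 bMul = imem st bMul by rewrite st4E.
        have g4 : imem st4 g = imem st g by rewrite st4E // gW.
        have y4 : imem st4 iY 0 = y.
          by case: fr4 => -> //; case: fr3 => -> //; case: fr2 => ->.
        have b4 : imem st4 iB 0 = b by case: fr4 => -> //; case: fr3 => ->.
        have c4 : imem st4 iC 0 = c by case: fr4 => ->.
        have := run0 st4; rewrite K4 L4 m4 g4 y4 b4 c4 ir => run4.
        apply: emits_le (run4 mulE (ltnW yK) _ rdy4) => //; last by lia.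
        by rewrite leq_mul.
      - by [].
      - by apply: leq_mul; first exact: leqnn.
    * by rewrite e2.
    * (* A gap of b + 2 < K has 2b + 5 shifts, about twice the side: hence 22
         from 11. *)
      rewrite e2; apply: leq_mul; first exact: leqnn.
      rewrite [leqRHS](_ : _ = 2 * K.+1 * (11 * K.+1))%N; last by ring.
      by apply: leq_mul => //; lia.
  + by rewrite e1.
  + by rewrite e1; apply: leq_mul; [exact: leqnn|apply: leq_mul => //; lia].
- by [].
- have pow4 a : (a * (K.+1 * (K.+1 * (K.+1 * (22 * K.+1)))) <= (a * 22) * K.+1 ^ 4)%N.
    by rewrite leq_eqVlt; apply/orP; left; apply/eqP; ring.
  exact: pow4.
Qed.

Definition grid_output (pts : seq (plane R)) (m s : nat) (out : seq (seq nat)) : Prop :=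
  let n := size pts in let L := (m * s)%N in let K := (10 * L)%N in
  let X i := (nth 0 pts i).1 in let Y i := (nth 0 pts i).2 in
  exists D Rows Cols,
    let cx i := cell_of K D (X i - X 0%N) in let cy i := cell_of K D (Y i - Y 0%N) in
    [/\ is_radius X Y n D,
        tabled Rows (fun i => cy i * (3 * K) + (K + cx i))%N n,
        tabled Cols (fun i => cx i * (3 * K) + (K + cy i))%N n &
        out = swept_paths K L Rows ++ swept_paths K L Cols].

(** All phases fit in [O(K ^ 4)], as both [n] and [K] are at most [K ^ 2]. *)
Lemma runs_cover_program m : (0 < m)%N -> exists c, forall pts : seq (plane R),
  let n := size pts in
  exists s, [/\ (n <= s ^ 2)%N, (s ^ 2 <= 4 * n)%N &
    runs (cover_program m) (initial_state pts) (c * (10 * (m * s)).+1 ^ 4)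
      (fun st' => grid_output pts m s (written_paths st'))].
Proof.
move=> m0.
have [c1 run1] := runs_ceil_sqrt; have [c2 run2] := runs_grid_size m.
have [c3 run3] := runs_multiples; have [c4 run4] := runs_radius.
have [c5 run5] := runs_fill_tables.
have [c6 run6] := @emits_sweep bRows isT; have [c7 run7] := @emits_sweep bCols isT.
exists (c1 + (c2 + (c3 + (c4 + (c5 + (c6 + c7))))))%N => pts n.
have [t1 [st1 [ex1 le1 [n_s s_n [fi1 fr1 fo1]]]]] := run1 (initial_state pts) erefl erefl.
set s := imem st1 bS 0 in n_s s_n; exists s; split=> //.
set K := (10 * (m * s))%N; set x := (K.+1 ^ 4)%N.
have sK : (s <= K)%N by rewrite /K mulnA leq_pmull // muln_gt0 m0.
have nK : (n.+1 <= K.+1 ^ 2)%N.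
  by rewrite (leq_trans (_ : _ <= (s ^ 2).+1)%N) // -!mulnn; nia.
have x1 : (1 <= x)%N by rewrite expn_gt0.
have xK : (K.+1 <= x)%N by rewrite -[leqLHS]expn1 leq_pexp2l.
have xn : (n.+1 <= x)%N by rewrite (leq_trans nK) // leq_pexp2l.
have xnK : (n.+1 * K.+1 <= x)%N.
  by rewrite /x (expnSr _ 3) leq_mul // (leq_trans nK) // leq_pexp2l.
have scaled c st t a Q : (t <= x)%N -> runs c st (a * t) Q -> runs c st (a * x) Q.
  by move=> tx; apply: runs_mono => //; rewrite leq_mul2l tx orbT.
apply: (@runs_seq_scaled _ _ _ _ _ _ _ (eq^~ st1)).
  by apply: (scaled _ _ _ _ _ xn); exists t1, st1.
move=> _ ->; apply: runs_seq_scaled; first exact: (scaled _ _ _ _ _ x1 (run2 st1)).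
move=> st2 [L2 K2 W2 [fi2 fr2 fo2]]; rewrite -/s -/K in L2 K2 W2.
apply: runs_seq_scaled.
  have := run3 st2; rewrite K2 => run.
  apply: (scaled _ _ _ _ _ xK (run _ _)); first by rewrite fi2 // fi1.
  by rewrite fr2 // fr1.
move=> st3 [arith [fi3 fr3 fo3]]; rewrite W2 in arith.
have K3 : imem st3 bK 0 = K by rewrite fi3.
have N3 : imem st3 bN 0 = n by rewrite fi3 // fi2 // fi1.
apply: runs_seq_scaled.
  have := run4 st3; rewrite N3 => run.
  by apply: (scaled _ _ _ _ _ xn (run _)); rewrite fr3 // fr2 // fr1.
move=> st4 [radius4 [fi4 fr4 fo4]].
have K4 : imem st4 bK 0 = K by rewrite fi4.
have N4 : imem st4 bN 0 = n by rewrite fi4.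
have rX4 : rmem st4 rX = fun a => (nth 0 pts a).1.
  by rewrite fr4 // fr3 // fr2 // fr1.
have rY4 : rmem st4 rY = fun a => (nth 0 pts a).2.
  by rewrite fr4 // fr3 // fr2 // fr1.
apply: runs_seq_scaled.
  have := run5 st4; rewrite K4 N4 => run.
  apply: (scaled _ _ _ _ _ xnK (run _ _ _)).
  - by move=> k kK; rewrite fi4 // fr4 //; exact: arith.
  - by move=> a; rewrite fi4 // fi3 // fi2 // fi1.
  - by move=> a; rewrite fi4 // fi3 // fi2 // fi1.
move=> st5 [rows cols [fi5 fr5 fo5]].
have K5 : imem st5 bK 0 = K by rewrite fi5.
have L5 : imem st5 bL 0 = (m * s)%N by rewrite fi5 // fi4 // fi3.
have mul5 k : (k <= K)%N -> imem st5 bMul k = (k * (3 * K))%N.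
  by move=> kK; rewrite fi5 // fi4 //; case: (arith k kK).
have rdy5 : ready st5.
  split; first by rewrite fi5 // fi4 // fi3 // fi2 // fi1.
  by rewrite (fo5 isT).1 (fo4 isT).1 (fo3 isT).1 (fo2 isT).1 (fo1 isT).1.
have out5 : written_paths st5 = [::].
  by rewrite (fo5 isT).2 (fo4 isT).2 (fo3 isT).2 (fo2 isT).2 (fo1 isT).2.
have LK : (m * s <= K)%N by rewrite /K leq_pmull.
apply: runs_seq_scaled.
  by have := run6 st5; rewrite K5 L5; apply.
move=> st6 [rdy6 out6 [fi6 _ _]].
apply: (@runs_mono _ _ _ (c7 * x) _ (fun st' => written_paths st' =
    written_paths st6 ++ swept_paths K (m * s) (imem st6 bCols))) => //; last first.
  have := run7 st6; rewrite (fi6 bK) // K5 (fi6 bL) // L5 (fi6 bMul) // => run.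
  by apply: runs_mono (leqnn _) _ (run mul5 LK rdy6) => st' [].
move=> st7 ->; rewrite out6 out5 (fi6 bCols) //.
exists (rmem st4 rD 0%N), (imem st5 bRows), (imem st5 bCols); split=> //.
- by move: radius4; rewrite -(fr4 rX) // -(fr4 rY) // rX4 rY4.
- by move: rows; rewrite rX4 rY4.
- by move: cols; rewrite rX4 rY4.
Qed.
End Correctness.

(** * The paths of a sweep *)

Lemma pairwise_gather (T : Type) (r : rel T) n (f : nat -> seq T) :
  (forall k, (k < n)%N -> pairwise r (f k)) ->
  (forall k k', (k < k')%N -> (k' < n)%N -> allrel r (f k) (f k')) ->
  pairwise r (gather n f).
Proof.
elim: n => [//|n IH] rf rff; rewrite gatherS pairwise_cat; apply/and3P; split.
- suff all_fn m : (m <= n)%N -> allrel r (gather m f) (f n) by exact: all_fn.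
  elim: m => [//|m IHm] mn; rewrite gatherS allrel_catl.
  by rewrite IHm ?rff // ltnW.
- apply: IH => [k kn|k k' kk' k'n]; first by apply: rf; apply: ltnW.
  by apply: rff => //; apply: ltnW.
- exact: rf.
Qed.

Lemma divn_decomp_inj d r u r' u' : (u < d)%N -> (u' < d)%N ->
  (r * d + u = r' * d + u')%N -> r = r' /\ u = u'.
Proof.
move=> ud u'd e; have d0 : (0 < d)%N by apply: leq_ltn_trans ud.
have := congr1 (divn^~ d) e; rewrite !divnMDl // !divn_small // !addn0 => er.
by split=> //; move: e; rewrite er => /addnI.
Qed.

Lemma tabled_entry G addr n a : tabled G addr n -> (0 < G a)%N ->
  exists i, [/\ (i < n)%N, a = addr i & G a = i.+1].
Proof. by move=> /(_ a)[//|[-> _]]. Qed.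

Lemma tabled_lookup G addr n i : tabled G addr n -> {in gtn n &, injective addr} ->
  (i < n)%N -> G (addr i) = i.+1.
Proof.
move=> tG inj lti; case: (tG (addr i)) => [[j [ltj eij ->]]|[_ /(_ i lti)//]].
by rewrite (inj i j).
Qed.

Section Sweep.
Variables (n L : nat) (G row col : nat -> nat).
Let K := (10 * L)%N.
Hypothesis rowK : forall i, (i < n)%N -> (row i < K)%N.
Hypothesis colK : forall i, (i < n)%N -> (col i < K)%N.
Let addr i := (row i * (3 * K) + (K + col i))%N.
Hypothesis tabG : tabled G addr n.

(** A positive entry determines row and column, because both columns lie in
    the range [0 .. 3 * K - 1] of one row. *)
Lemma edge_at_sound y b c x : (y < K)%N -> (b < K - 2)%N ->
  (c < b.+2 + (b.+2 + 1))%N -> (x < K)%N -> edge_at K G y b c x != [::] ->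
  exists i j, [/\ edge_at K G y b c x = [:: i; j], (i < n)%N, (j < n)%N &
    [/\ row i = y, col i = x, row j = (y + b.+2)%N & (col j + b.+2 = x + c)%N]].
Proof.
move=> yK bK cb xK; rewrite /edge_at; case: ifP => // /andP[lo up] _.
have [i [ltin ei Ei]] := tabled_entry tabG lo.
have [j [ltjn ej Ej]] := tabled_entry tabG up.
exists i, j; rewrite /lower_cell /upper_cell Ei Ej; split=> //.
have Ki := colK ltin; have Kj := colK ltjn.
have [||ri ci] := divn_decomp_inj _ _ ei; [lia|lia|].
rewrite -mulnDl in ej.
have [||rj cj] := divn_decomp_inj _ _ ej; [lia|lia|].
by split; lia.
Qed.

Lemma edge_at_complete i j : {in gtn n &, injective addr} ->
  (i < n)%N -> (j < n)%N -> (row i + 2 <= row j)%N ->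
  (col i <= col j + (row j - row i))%N ->
  edge_at K G (row i) (row j - row i - 2) (col j + (row j - row i) - col i) (col i)
  = [:: i; j].
Proof.
move=> inj lti ltj rij cij.
have eb : (row j - row i - 2).+2 = (row j - row i)%N by lia.
have lo : lower_cell K G (row i) (col i) = i.+1 by exact: (tabled_lookup tabG inj lti).
have up : upper_cell K G (row i) (row j - row i - 2)
    (col j + (row j - row i) - col i) (col i) = j.+1.
  rewrite -(tabled_lookup tabG inj ltj) /upper_cell eb -mulnDl /addr; congr G.
  by congr (_ * _ + _)%N; lia.
by rewrite /edge_at lo up.
Qed.

(** The loop indices that find the edge are its row, row gap, shifted column
    difference and the residue of its column modulo 10. *)
Lemma swept_paths_complete i j : {in gtn n &, injective addr} ->
  (i < n)%N -> (j < n)%N -> (row i + 2 <= row j)%N ->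
  (col i <= col j + (row j - row i))%N -> (col j <= col i + (row j - row i))%N ->
  exists s1 s2, s1 ++ [:: i; j] ++ s2 \in swept_paths K L G.
Proof.
move=> inj lti ltj rij cij cji.
set y := row i; set b := (row j - row i - 2)%N.
set c := (col j + (row j - row i) - col i)%N; set r := (col i %% 10)%N.
have [|s1 [s2 es]] := @gather_cat nat L (col i %/ 10) (fun k => edge_at K G y b c (r + 10 * k)).
  by rewrite ltn_divLR // mulnC colK.
exists s1, s2; have ex : (r + 10 * (col i %/ 10) = col i)%N.
  by rewrite addnC mulnC -divn_eq.
rewrite ex edge_at_complete // in es.
apply/gatherP; exists y; first exact: rowK.
apply/gatherP; exists b; first by have := rowK ltj; lia.
apply/gatherP; exists c; first by lia.
apply/gatherP; exists r; first by rewrite ltn_mod.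
by rewrite /keep_nonempty /swept_path es; case: s1 {es} => [|v s1]; rewrite inE.
Qed.

Variables (R : realType) (X Y : nat -> R) (w : R).
Hypothesis w0 : (1 < n)%N -> 0 < w.
Hypothesis Xcol : forall i, (i < n)%N -> w * (col i)%:R <= X i <= w * (col i).+1%:R.
Hypothesis Yrow : forall i, (i < n)%N -> w * (row i)%:R <= Y i <= w * (row i).+1%:R.

(** A difference of coordinates differs from the difference of the cell indices by
    at most one cell.  In the direction [(beta, 5 - a)] this error is at most
    [beta + `|5 - a|], hence at most [2 * beta + 5]; an ascent of [5 * beta] between
    the cells leaves at least [3 * beta - 5], which is positive for [2 <= beta]. *)
Lemma ascent_between_cells (beta a : R) i j : (i < n)%N -> (j < n)%N -> 0 < w ->
  -beta <= a <= beta -> 2 <= beta ->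
  3 * beta - 5 <= beta * ((col j)%:R - (col i)%:R) +
           (5 - a) * ((row j)%:R - (row i)%:R) - 2 * beta - 5 ->
  0 < beta * (X j - X i) + (5 - a) * (Y j - Y i).
Proof.
move=> lti ltj w_gt0 /andP[a1 a2] b2 H.
have := Xcol lti; have := Xcol ltj; have := Yrow lti; have := Yrow ltj.
have nS k : k.+1%:R = k%:R + 1 :> R by rewrite natr1.
rewrite !(nS (col _)) !(nS (row _)) => /andP[y1 y2] /andP[y3 y4] /andP[x1 x2] /andP[x3 x4].
set A := (col j)%:R - (col i)%:R in H; set B := (row j)%:R - (row i)%:R in H.
have hX : - w <= X j - X i - w * A by rewrite /A; lra.
have hY : - w <= Y j - Y i - w * B <= w by rewrite /B; apply/andP; split; lra.
have e1 : - (beta * w) <= beta * (X j - X i - w * A) by rewrite -mulrN ler_wpM2l //; lra.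
have e2 : - ((5 + beta) * w) <= (5 - a) * (Y j - Y i - w * B).
  case/andP: hY; set d := Y j - Y i - w * B => d1 d2.
  have [h|h] := lerP 0 (5 - a); nra.
have : w * (3 * beta - 5) <= w * (beta * A + (5 - a) * B - 2 * beta - 5) by rewrite ler_pM2l.
have : 0 < w * (3 * beta - 5) by rewrite mulr_gt0 //; lra.
lra.
Qed.

(** Between the cells of an edge, the ascent is [beta * a + (5 - a) * beta], that is
    [5 * beta].  From the upper cell of an edge to the lower cell of a later edge of
    the same path it is [beta * (x' - x - a) - (5 - a) * beta], where the columns
    [x] and [x'] differ by at least 10: again at least [5 * beta].  A path
    has an edge, hence two points, which makes the scale [w] positive. *)
Lemma swept_paths_monotone s : s \in swept_paths K L G ->
  [/\ s != [::], all (gtn n) s &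
   exists u v : R, 0 < u /\
     sorted (fun i j => 0 < u * (X j - X i) + v * (Y j - Y i)) s].
Proof.
move=> /gatherP[y yK /gatherP[b bK /gatherP[c cb /gatherP[r r10]]]].
rewrite /keep_nonempty; case: ifP => // s0; rewrite inE => /eqP->.
have xK k : (k < L)%N -> (r + 10 * k < K)%N by rewrite /K; lia.
have edgeE k : (k < L)%N -> edge_at K G y b c (r + 10 * k) != [::] ->
   exists i j, [/\ edge_at K G y b c (r + 10 * k) = [:: i; j], (i < n)%N, (j < n)%N &
    [/\ row i = y, col i = (r + 10 * k)%N, row j = (y + b.+2)%N &
        (col j + b.+2 = r + 10 * k + c)%N]].
  by move=> kL; apply: edge_at_sound => //; exact: xK.
split; first by rewrite s0.
  apply/allP => v /gatherP[k kL vk].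
  have [|i [j [e lti ltj _]]] := edgeE k kL; first by apply/eqP => e; rewrite e in vk.
  by move: vk; rewrite e !inE => /orP[]/eqP->.
pose beta : R := b.+2%:R; pose a : R := c%:R - beta.
have beta2 : 2 <= beta by rewrite ler_nat.
have abeta : - beta <= a <= beta.
  rewrite /a /beta; have : c%:R <= (2 * b.+2)%:R :> R by rewrite ler_nat; lia.
  have : 0 <= c%:R :> R by [].
  by rewrite natrM => ? ?; apply/andP; split; lra.
exists beta, (5 - a); split; first by lra.
set ord := fun i j => _.
have ord_trans : transitive ord by move=> j i k; rewrite /ord; lra.
have wpos i j : (i < n)%N -> (j < n)%N -> (row i < row j)%N -> 0 < w.
  move=> lti ltj rij; apply: w0; case: (ltnP 1 n) => // n1.
  have eij : i = j by lia.
  by rewrite eij ltnn in rij.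
have within x i j : (i < n)%N -> (j < n)%N -> row i = y -> col i = x ->
    row j = (y + b.+2)%N -> (col j + b.+2 = x + c)%N -> ord i j.
  move=> lti ltj ri ci rj cj; apply: ascent_between_cells => //.
    by apply: (wpos i j) => //; lia.
  have {}cj : (col j)%:R + beta = x%:R + c%:R :> R by rewrite -!natrD cj.
  rewrite ri ci rj (natrD _ y) -/beta.
  have -> : (col j)%:R - x%:R = a by rewrite /a; lra.
  lra.
rewrite sorted_pairwise //; apply: pairwise_gather => [k kL|k k' kk' k'L].
  have [->//|ne] := eqVneq (edge_at K G y b c (r + 10 * k)) [::].
  have [i [j [-> lti ltj [ri ci rj cj]]]] := edgeE k kL ne.
  by rewrite /= !andbT; apply: within cj.
have [->//|ne] := eqVneq (edge_at K G y b c (r + 10 * k)) [::].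
have [->|ne'] := eqVneq (edge_at K G y b c (r + 10 * k')) [::].
  by rewrite allrel0r.
have kL : (k < L)%N := ltn_trans kk' k'L.
have [i [j [-> lti ltj [ri ci rj cj]]]] := edgeE k kL ne.
have [i' [j' [-> lti' ltj' [ri' ci' rj' cj']]]] := edgeE k' k'L ne'.
have ij : ord i j by apply: within cj.
have ij' : ord i' j' by apply: within cj'.
have ji' : ord j i'.
  apply: ascent_between_cells => //; first by apply: (wpos i j) => //; lia.
  have {}cj : (col j)%:R = (r + 10 * k)%:R + c%:R - beta :> R.
    by rewrite /beta -natrD -cj natrD addrK.
  rewrite cj ci' rj ri' (natrD _ y) -/beta.
  have : (r + 10 * k)%:R + 10 <= (r + 10 * k')%:R :> R.
    by rewrite -(natrD _ _ 10) ler_nat; lia.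
  move: (r + 10 * k)%:R (r + 10 * k')%:R => x x' xx'.
  have : 0 <= beta * (x' - x - 10) by rewrite mulr_ge0 //; lra.
  rewrite (_ : c%:R = a + beta); last by rewrite /a; lra.
  nra.
rewrite allrel_cons2 /= /allrel /= !andbT.
by rewrite ji' (ord_trans _ _ _ ij ji') (ord_trans _ _ _ ji' ij')
  (ord_trans _ _ _ (ord_trans _ _ _ ij ji') ij').
Qed.
End Sweep.

(** * Cells and density *)

(** The last cell is closed, since the coordinate [D] itself belongs to the
    square; hence the upper bound is not strict. *)
Lemma cell_ofP (R : realType) K (D v : R) : (0 < K)%N -> `|v| <= D ->
  [/\ (cell_of K D v < K)%N, 2 * D * (cell_of K D v)%:R <= K%:R * (v + D) &
      K%:R * (v + D) <= 2 * D * (cell_of K D v).+1%:R].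
Proof.
move=> K0; rewrite ler_norml => /andP[v1 v2]; rewrite /cell_of; set P := fun k => _.
have K0R : 0 <= K%:R :> R by [].
have [|//|ltK Pc max_c] := @last_suchP P K.
  by rewrite /P mulr0 mulr_ge0 //; lra.
split=> //; set c := last_such P K in ltK Pc max_c *.
have [cK|cK] := ltnP c.+1 K.
  by apply/ltW; rewrite ltNge; apply/negP => /(max_c _ cK); rewrite ltnn.
have -> : c.+1 = K by apply/eqP; rewrite eqn_leq cK andbT.
rewrite mulrC ler_wpM2r //; lra.
Qed.

(** Coordinates in the same or in adjacent cells differ by at most two cell
    widths, each of them [2 * D / K]. *)
Lemma near_cells (R : realType) K (D v v' : R) : (0 < K)%N -> `|v| <= D -> `|v'| <= D ->
  (cell_of K D v <= (cell_of K D v').+1)%N -> K%:R * (v - v') <= 4 * D.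
Proof.
move=> K0 vD v'D; have D0 : 0 <= D by apply: le_trans vD.
have [_ _ h1] := cell_ofP K0 vD; have [_ h2 _] := cell_ofP K0 v'D.
rewrite -ltnS -(ler_nat R); set c := cell_of K D v in h1 *; set c' := cell_of K D v' in h2 *.
have -> : c'.+2%:R = c'%:R + 2 :> R by rewrite -natrD addn2.
move=> cc'; have : 2 * D * c.+1%:R <= 2 * D * (c'%:R + 2) by rewrite ler_wpM2l //; lra.
lra.
Qed.

(** The constant 6 is an upper bound of [4 * sqrt 2]. *)
Lemma scaled_norm_le (R : realType) (k a b d D : R) : 0 <= k -> 0 <= d -> 0 <= D ->
  k * a <= 4 * D -> k * - a <= 4 * D -> k * b <= 4 * D -> k * - b <= 4 * D ->
  d ^+ 2 = a ^+ 2 + b ^+ 2 -> k * d <= 6 * D.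
Proof.
move=> k0 d0 D0; rewrite !mulrN => a1 a2 b1 b2 dE.
rewrite -(ler_pXn2r (_ : 0 < 2)%N) ?nnegrE ?mulr_ge0 //.
rewrite exprMn dE mulrDr -!exprMn.
have sq (z : R) : z <= 4 * D -> - z <= 4 * D -> z ^+ 2 <= 16 * D ^+ 2 by move=> *; nra.
have := sq _ a1 a2; have := sq _ b1 b2; have := sqr_ge0 D.
by rewrite !expr2; lra.
Qed.

Lemma two_indices n i j : (i < n)%N -> (j < n)%N -> i != j -> (1 < n)%N.
Proof. lia. Qed.

Section Density.
Variable R : realType.
Implicit Types (A : {fset plane R}) (p q : plane R).

Lemma ex_max_seq (s : seq R) : s != [::] -> exists2 d, d \in s & forall x, x \in s -> x <= d.
Proof.
elim: s => [//|x [|y s] IH] _.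
  by exists x; rewrite ?inE // => z; rewrite inE => /eqP->.
have [d ds max_d] := IH isT; have [xd|dx] := lerP x d.
  by exists d => [|z]; rewrite inE ?ds ?orbT // => /orP[/eqP->//|/max_d].
exists x => [|z]; rewrite inE ?eqxx // => /orP[/eqP->//|/max_d zd].
exact/ltW/(le_lt_trans zd).
Qed.

Lemma dist_sqr p q : dist p q ^+ 2 = (p.1 - q.1) ^+ 2 + (p.2 - q.2) ^+ 2.
Proof.
rewrite /dist sqr_sqrtr; first by rewrite /dot /=; ring.
by rewrite /dot -!expr2 addr_ge0 ?sqr_ge0.
Qed.

Lemma dist_ge0 p q : 0 <= dist p q. Proof. exact: sqrtr_ge0. Qed.

Lemma dist_gt0 p q : p != q -> 0 < dist p q.
Proof.
move=> pq; rewrite lt_def dist_ge0 andbT; apply: contra pq => /eqP d0.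
have := dist_sqr p q; rewrite d0 expr0n /= => /esym/eqP.
rewrite paddr_eq0 ?sqr_ge0 // !sqrf_eq0 !subr_eq0 => /andP[/eqP e1 /eqP e2].
by case: p q e1 e2 {d0} => [p1 p2] [q1 q2] /= -> ->.
Qed.

Lemma coord_le_dist p q : `|p.1 - q.1| <= dist p q /\ `|p.2 - q.2| <= dist p q.
Proof.
by split; rewrite -(ler_pXn2r (_ : 0 < 2)%N) ?nnegrE ?dist_ge0 ?normr_ge0 //
  real_normK ?num_real // dist_sqr ?lerDl ?lerDr sqr_ge0.
Qed.

(** The longest and shortest distances of the definition of density exist because
    there are finitely many distances. *)
Lemma dense_ratio (alpha : R) A p q p' q' : alpha_dense alpha A ->
  p \in A -> q \in A -> p != q -> p' \in A -> q' \in A -> p' != q' ->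
  dist p q <= alpha * Num.sqrt (#|` A|%:R) * dist p' q'.
Proof.
move=> dense pA qA pq pA' qA' pq'.
pose ds := [seq dist x.1 x.2 | x <- [seq (x, y) | x <- enum_fset A, y <- enum_fset A] & x.1 != x.2].
have dsP d : d \in ds <-> distance_in A d.
  split=> [/mapP[x]|[x [y [xA yA xy ->]]]].
    rewrite mem_filter => /andP[ne /allpairsP[[x1 x2] [/= A1 A2 ex]]] ->.
    by rewrite ex in ne *; exists x1, x2.
  apply/mapP; exists (x, y) => //; rewrite mem_filter xy /=.
  by apply/allpairsP; exists (x, y).
have pd : dist p q \in ds by apply/dsP; exists p, q.
have pd' : dist p' q' \in ds by apply/dsP; exists p', q'.
have ds0 : ds != [::] by apply/eqP => e; rewrite e in pd.
have [dmax dmax_in dmax_max] := ex_max_seq ds0.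
have [|d' dmin_in dmin_min] := @ex_max_seq [seq - d | d <- ds].
  by case: (ds) ds0.
have [dmin dmin_ds ed'] := mapP dmin_in.
have long : longest_distance A dmax.
  by split=> [|d /dsP]; [exact/dsP|exact: dmax_max].
have short : shortest_distance A dmin.
  split=> [|d /dsP dd]; first exact/dsP.
  by have := dmin_min _ (map_f -%R dd); rewrite ed' lerN2.
have [x [y [_ _ xy edmin]]] : distance_in A dmin by apply/dsP.
have dmin_gt0 : 0 < dmin by rewrite edmin dist_gt0.
have := dense _ _ long short; rewrite ler_pdivrMr // => h.
have h1 := dmax_max _ pd; have h2 := short.2 _ ((dsP _).1 pd').
have r0 : 0 <= alpha * Num.sqrt (#|` A|%:R).
  by rewrite -(pmulr_lge0 _ dmin_gt0) (le_trans _ h) // (le_trans (dist_ge0 p q)).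
exact: le_trans h1 (le_trans h (ler_wpM2l r0 h2)).
Qed.

End Density.

(** At most [K] rows, [K] gaps, [2 * K] shifts and 10 residues. *)
Lemma size_swept_paths K L G : (size (swept_paths K L G) <= 20 * K ^ 3)%N.
Proof.
have -> : (20 * K ^ 3 = K * (K * (2 * K * (10 * 1))))%N by ring.
apply: size_gather => y _.
apply: (@leq_trans ((K - 2) * (2 * K * (10 * 1)))); last by rewrite leq_mul // leq_subr.
apply: size_gather => b bK.
apply: (@leq_trans ((b.+2 + (b.+2 + 1)) * (10 * 1))); last by rewrite leq_mul //; lia.
apply: size_gather => c _; apply: size_gather => r _.
by rewrite /keep_nonempty; case: ifP.
Qed.

Lemma mem_path_edges (R : realType) (p q : plane R) s1 s2 :
  [fset p; q]%fset \in path_edges (s1 ++ p :: q :: s2).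
Proof.
elim: s1 => [|x s1 IH]; first by rewrite /path_edges /= mem_head.
by rewrite /path_edges /= in IH *; case: s1 IH => [|y s1] IH /=; rewrite inE ?IH ?orbT.
Qed.

Section GridCover.
Variables (R : realType) (alpha : R) (A : {fset plane R}) (pts : seq (plane R)).
Hypothesis alpha_gt0 : 0 < alpha.
Hypothesis dense : alpha_dense alpha A.
Hypothesis ptsA : perm_eq pts (enum_fset A).
Variables (m s : nat).
Hypothesis alpha_m : alpha <= m%:R.
Let n := size pts.
Hypothesis n_s : (n <= s ^ 2)%N.
Let X i := (nth 0 pts i).1.
Let Y i := (nth 0 pts i).2.
Let L := (m * s)%N.
Let K := (10 * L)%N.
Variable D : R.
Hypothesis radD : is_radius X Y n D.
Let cx i := cell_of K D (X i - X 0%N).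
Let cy i := cell_of K D (Y i - Y 0%N).

Lemma pts_uniq : uniq pts.
Proof. by rewrite (perm_uniq ptsA) fset_uniq. Qed.

Lemma mem_pts p : (p \in pts) = (p \in A).
Proof. by rewrite (perm_mem ptsA). Qed.

Lemma nth_pts i : (i < n)%N -> nth 0 pts i \in A.
Proof. by move=> lti; rewrite -mem_pts mem_nth. Qed.

Lemma card_pts : #|` A| = n.
Proof. by rewrite /n (perm_size ptsA). Qed.

Lemma nth_pts_eq i j : (i < n)%N -> (j < n)%N -> i != j -> nth 0 pts i != nth 0 pts j.
Proof. by move=> lti ltj; rewrite nth_uniq ?pts_uniq. Qed.

Lemma K_gt0 i : (i < n)%N -> (0 < K)%N.
Proof.
move=> lti; have m0 : (0 < m)%N by rewrite -(ltr_nat R) (lt_le_trans alpha_gt0).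
have s0 : (0 < s)%N by case: (s) n_s => //; lia.
by rewrite /K /L !muln_gt0 m0 s0.
Qed.

Lemma radius_gt0 : (1 < n)%N -> 0 < D.
Proof.
move=> n1; rewrite ltNge; apply/negP => D0.
have [bnd _] := radD; have [X1 Y1] := bnd 1%N n1.
have /negP[] := nth_pts_eq n1 (ltnW n1) (isT : 1%N != 0%N).
have := le_trans X1 D0; have := le_trans Y1 D0.
rewrite !normr_le0 !subr_eq0 /X /Y => /eqP e2 /eqP e1.
by apply/eqP; move: e1 e2; case: (nth 0 pts 1) => a b; case: (nth 0 pts 0) => a' b' /= -> ->.
Qed.

(** The radius is a coordinate difference of two points of the set, hence at most
    the diameter. *)
Lemma radius_le_dist p q : p \in A -> q \in A -> p != q ->
  D <= alpha * Num.sqrt n%:R * dist p q.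
Proof.
move=> pA qA pq; have r0 : 0 <= alpha * Num.sqrt n%:R * dist p q.
  by rewrite !mulr_ge0 ?sqrtr_ge0 ?dist_ge0 // ltW.
case: radD => _ [->//|[i lti eD]].
have [ei|ne] := eqVneq (nth 0 pts i) (nth 0 pts 0).
  by case: eD => ->; rewrite /X /Y ei subrr normr0.
have h : dist (nth 0 pts i) (nth 0 pts 0) <= alpha * Num.sqrt n%:R * dist p q.
  rewrite -card_pts; apply: dense_ratio => //; apply: nth_pts => //.
  exact: leq_ltn_trans lti.
apply: le_trans h; have [h1 h2] := coord_le_dist (nth 0 pts i) (nth 0 pts 0).
by case: eD => ->.
Qed.

(** Two points in the same or in adjacent cells are at distance at most
    [6 * D / K], whereas density makes it at least [D / (alpha * sqrt n)], and [K] is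
    at least [10 * alpha * sqrt n]. *)
Lemma separated_cells i j : (i < n)%N -> (j < n)%N -> i != j ->
  ~~ [&& (cx i <= (cx j).+1)%N, (cx j <= (cx i).+1)%N,
         (cy i <= (cy j).+1)%N & (cy j <= (cy i).+1)%N].
Proof.
move=> lti ltj ij; apply/negP => /and4P[x1 x2 y1 y2].
have K0 := K_gt0 lti; have [bnd _] := radD.
have [[Xi Yi] [Xj Yj]] := (bnd i lti, bnd j ltj).
have := near_cells K0 Yj Yi y2; have := near_cells K0 Yi Yj y1.
have := near_cells K0 Xj Xi x2; have := near_cells K0 Xi Xj x1.
have subKK (a b c : R) : a - c - (b - c) = a - b by rewrite opprB addrA subrK.
rewrite !subKK => hx1 hx2 hy1 hy2.
set p := nth 0 pts i; set q := nth 0 pts j.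
have pq : p != q by apply: nth_pts_eq.
have d0 := dist_gt0 pq.
have D0 : 0 < D by apply/radius_gt0/(two_indices lti ltj ij).
have Dd := radius_le_dist (nth_pts lti) (nth_pts ltj) pq.
have dE : dist p q ^+ 2 = (X i - X j) ^+ 2 + (Y i - Y j) ^+ 2 by exact: dist_sqr.
have far : K%:R * dist p q <= 6 * D.
  apply: scaled_norm_le dE => //; rewrite ?opprB //; [exact: dist_ge0|exact: ltW].
have Ks : 10 * (alpha * Num.sqrt n%:R) <= K%:R.
  rewrite /K /L !natrM ler_wpM2l // ler_pM // ?sqrtr_ge0 ?(ltW alpha_gt0) //.
  rewrite -(ler_pXn2r (_ : 0 < 2)%N) ?nnegrE ?sqrtr_ge0 // sqr_sqrtr //.
  by rewrite -natrX ler_nat.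
set z := alpha * Num.sqrt n%:R in Dd Ks.
have : 10 * z * dist p q <= K%:R * dist p q by rewrite ler_wpM2r // ltW.
lra.
Qed.
Lemma path_of_indices (t : seq nat) (w : plane R) : w != 0 -> t != [::] ->
  all (gtn n) t -> sorted (fun i j => 0 < dot (nth 0 pts j - nth 0 pts i) w) t ->
  path_in A [seq nth 0 pts i | i <- t] /\ monotone_path [seq nth 0 pts i | i <- t].
Proof.
move=> w0 t0 /allP tn mono; split.
  apply/andP; split; first by case: (t) t0.
  by apply/allP => p /mapP[i /tn it ->]; exact: nth_pts.
by exists w => //; rewrite /monotone_path_in sorted_map.
Qed.

(** Coordinates scaled so that cells have width [2 * D]. *)
Let Xs i := K%:R * (X i - X 0%N + D).
Let Ys i := K%:R * (Y i - Y 0%N + D).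

Lemma cells_in_grid i : (i < n)%N ->
  [/\ (cx i < K)%N, (cy i < K)%N,
      2 * D * (cx i)%:R <= Xs i <= 2 * D * (cx i).+1%:R &
      2 * D * (cy i)%:R <= Ys i <= 2 * D * (cy i).+1%:R].
Proof.
move=> lti; have K0 := K_gt0 lti; have [/(_ i lti)[Xi Yi] _] := radD.
have [x1 x2 x3] := cell_ofP K0 Xi; have [y1 y2 y3] := cell_ofP K0 Yi.
by split=> //; apply/andP.
Qed.

Variables Rows Cols : nat -> nat.
Hypothesis tabR : tabled Rows (fun i => cy i * (3 * K) + (K + cx i))%N n.
Hypothesis tabC : tabled Cols (fun i => cx i * (3 * K) + (K + cy i))%N n.

Lemma swept_path_sound t : t \in swept_paths K L Rows ++ swept_paths K L Cols ->
  all (gtn n) t /\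
  (path_in A [seq nth 0 pts i | i <- t] /\ monotone_path [seq nth 0 pts i | i <- t]).
Proof.
have D2 : (1 < n)%N -> 0 < 2 * D by move=> /radius_gt0; rewrite pmulr_rgt0.
have Kr_gt0 (n0 : (0 < n)%N) : 0 < K%:R :> R by rewrite ltr0n (K_gt0 n0).
rewrite mem_cat => /orP[] Ht.
- have [i lti|i lti|i lti|t0 tn [u [v [u0 mono]]]] :=
    @swept_paths_monotone n L Rows cy cx _ tabR R Xs Ys (2 * D) D2 _ _ t Ht.
  + by case: (cells_in_grid lti).
  + by case: (cells_in_grid lti).
  + by case: (cells_in_grid lti).
  have n0 : (0 < n)%N by case: (t) t0 tn => //= i t' _ /andP[+ _]; exact: leq_ltn_trans.
  split=> //; apply: (@path_of_indices _ (u, v)) => //.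
    by apply/eqP => -[u_eq0 _]; rewrite u_eq0 ltxx in u0.
  apply: sub_sorted mono => i j.
  rewrite (_ : u * _ + _ = K%:R * dot (nth 0 pts j - nth 0 pts i) (u, v)).
    by rewrite (pmulr_rgt0 _ (Kr_gt0 n0)).
  by rewrite /dot /Xs /Ys /X /Y /=; ring.
- have [i lti|i lti|i lti|t0 tn [u [v [u0 mono]]]] :=
    @swept_paths_monotone n L Cols cx cy _ tabC R Ys Xs (2 * D) D2 _ _ t Ht.
  + by case: (cells_in_grid lti).
  + by case: (cells_in_grid lti).
  + by case: (cells_in_grid lti).
  have n0 : (0 < n)%N by case: (t) t0 tn => //= i t' _ /andP[+ _]; exact: leq_ltn_trans.
  split=> //; apply: (@path_of_indices _ (v, u)) => //.
    by apply/eqP => -[_ u_eq0]; rewrite u_eq0 ltxx in u0.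
  apply: sub_sorted mono => i j.
  rewrite (_ : u * _ + _ = K%:R * dot (nth 0 pts j - nth 0 pts i) (v, u)).
    by rewrite (pmulr_rgt0 _ (Kr_gt0 n0)).
  by rewrite /dot /Xs /Ys /X /Y /=; ring.
Qed.

(** The coordinate in which the cells differ more decides which table is swept
    along the edge, and in that coordinate they differ by at least 2. *)
Lemma swept_paths_cover i j : (i < n)%N -> (j < n)%N -> i != j ->
  exists s1 s2,
    (s1 ++ [:: i; j] ++ s2 \in swept_paths K L Rows ++ swept_paths K L Cols) ||
    (s1 ++ [:: j; i] ++ s2 \in swept_paths K L Rows ++ swept_paths K L Cols).
Proof.
move=> lti ltj ij.
have cxK k : (k < n)%N -> (cx k < K)%N by move=> ltk; case: (cells_in_grid ltk).
have cyK k : (k < n)%N -> (cy k < K)%N by move=> ltk; case: (cells_in_grid ltk).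
have cell_inj k l : (k < n)%N -> (l < n)%N -> cx k = cx l -> cy k = cy l -> k = l.
  move=> ltk ltl ex ey; apply/eqP; apply/negPn/negP => kl.
  by have := separated_cells ltk ltl kl; rewrite ex ey !leqnSn.
have injR : {in gtn n &, injective (fun i => cy i * (3 * K) + (K + cx i))%N}.
  move=> k l /= ltk ltl e; have [||ey ex] := divn_decomp_inj _ _ e.
  - by rewrite mulSn ltn_add2l (leq_trans (cxK _ ltk)) // leq_pmull.
  - by rewrite mulSn ltn_add2l (leq_trans (cxK _ ltl)) // leq_pmull.
  by apply: cell_inj => //; apply: addnI ex.
have injC : {in gtn n &, injective (fun i => cx i * (3 * K) + (K + cy i))%N}.
  move=> k l /= ltk ltl e; have [||ex ey] := divn_decomp_inj _ _ e.
  - by rewrite mulSn ltn_add2l (leq_trans (cyK _ ltk)) // leq_pmull.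
  - by rewrite mulSn ltn_add2l (leq_trans (cyK _ ltl)) // leq_pmull.
  by apply: cell_inj => //; apply: addnI ey.
have inRows := swept_paths_complete cyK cxK tabR injR.
have inCols := swept_paths_complete cxK cyK tabC injC.
suff [] : (exists s1 s2, s1 ++ [:: i; j] ++ s2 \in swept_paths K L Rows ++ swept_paths K L Cols)
       \/ (exists s1 s2, s1 ++ [:: j; i] ++ s2 \in swept_paths K L Rows ++ swept_paths K L Cols).
- by move=> [s1 [s2 h]]; exists s1, s2; rewrite h.
- by move=> [s1 [s2 h]]; exists s1, s2; rewrite h orbT.
have := separated_cells lti ltj ij.
move: (inRows i j lti ltj) (inRows j i ltj lti) (inCols i j lti ltj) (inCols j i ltj lti).
move: (cx i) (cy i) (cx j) (cy j) => xi yi xj yj Rij Rji Cij Cji far.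
have [h|[h|[h|h]]] :
    (yi + 2 <= yj /\ xi <= xj + (yj - yi) /\ xj <= xi + (yj - yi) \/
    (yj + 2 <= yi /\ xj <= xi + (yi - yj) /\ xi <= xj + (yi - yj) \/
    (xi + 2 <= xj /\ yi <= yj + (xj - xi) /\ yj <= yi + (xj - xi) \/
     xj + 2 <= xi /\ yj <= yi + (xi - xj) /\ yi <= yj + (xi - xj))))%N.
- move: far; clear; lia.
- case: h => [h1 [h2 h3]]; have [s1 [s2 h]] := Rij h1 h2 h3.
  by left; exists s1, s2; rewrite mem_cat h.
- case: h => [h1 [h2 h3]]; have [s1 [s2 h]] := Rji h1 h2 h3.
  by right; exists s1, s2; rewrite mem_cat h.
- case: h => [h1 [h2 h3]]; have [s1 [s2 h]] := Cij h1 h2 h3.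
  by left; exists s1, s2; rewrite mem_cat h orbT.
- case: h => [h1 [h2 h3]]; have [s1 [s2 h]] := Cji h1 h2 h3.
  by right; exists s1, s2; rewrite mem_cat h orbT.
Qed.

Lemma swept_monotone_cover :
  monotone_path_cover A
    [seq [seq nth 0 pts i | i <- t] | t <- swept_paths K L Rows ++ swept_paths K L Cols].
Proof.
split=> [t /mapP[t' /swept_path_sound[_ h] -> //]|e].
case/imfsetP => -[p q] /=; rewrite inE /= => /andP[/allpairsP[[p' q'] [/= pA qA [-> ->]]] pq] ->.
rewrite -!mem_pts in pA qA.
have [|||s1 [s2 /orP[]h]] := @swept_paths_cover (index p' pts) (index q' pts).
- by rewrite index_mem.
- by rewrite index_mem.
- by apply: contra pq => /eqP e'; rewrite -(nth_index 0 pA) e' nth_index.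
- exists [seq nth 0 pts i | i <- s1 ++ [:: index p' pts; index q' pts] ++ s2].
    exact: map_f.
  by rewrite !map_cat /= !nth_index //; exact: mem_path_edges.
- exists [seq nth 0 pts i | i <- s1 ++ [:: index q' pts; index p' pts] ++ s2].
    exact: map_f.
  by rewrite !map_cat /= !nth_index // fsetUC; exact: mem_path_edges.
Qed.
End GridCover.

(** * Matchings *)

(** Each set is replaced by what the later ones leave of it, and empty remainders
    are dropped. *)
Lemma ex_disjoint_refinement (T : choiceType) (Ms : seq {fset T}) :
  exists F : {fset {fset T}},
    [/\ trivIfset F, forall x, x \in fcover F <-> exists2 M, M \in Ms & x \in M,
        (#|` F| <= size Ms)%N &
        forall N, N \in F -> N != fset0 /\ exists2 M, M \in Ms & (N `<=` M)%fset].
Proof.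
have in_cover (F : {fset {fset T}}) x :
    x \in fcover F <-> exists2 N, N \in F & x \in N.
  split=> [/bigfcupP[N]|[N NF xN]]; first by rewrite andbT; exists N.
  by apply/bigfcupP; exists N; rewrite ?andbT.
elim: Ms => [|M Ms [F [trivF covF cardF subF]]].
  exists fset0; split=> [|x||N]; rewrite ?cardfs0 ?in_fset0 //.
  by apply/trivIfsetP => N N'; rewrite in_fset0.
pose N := (M `\` fcover F)%fset.
have sub_N x : x \in M -> x \notin fcover F -> x \in N by move=> xM xF; rewrite in_fsetD xF.
have [N0|N0] := eqVneq N fset0.
  exists F; split=> [//|x||N' /subF[ne [M' M'Ms sub]]].
  - split=> [xF|[M']].
      have [M' M'Ms xM'] := (covF x).1 xF.
      by exists M'; rewrite // inE M'Ms orbT.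
    rewrite inE => /predU1P[->|M'Ms] xM'; last by apply/covF; exists M'.
    by apply/negPn/negP => xF; have := sub_N x xM' xF; rewrite N0 in_fset0.
  - exact: leqW.
  - by split=> //; exists M' => //; rewrite inE M'Ms orbT.
exists (N |` F)%fset; split=> [|x||N'].
- have disj N' : N' \in F -> [disjoint N & N']%fset.
    move=> N'F; apply/fdisjointP => x; rewrite in_fsetD => /andP[xF _].
    by apply: contra xF => xN'; apply/in_cover; exists N'.
  apply/trivIfsetP => B B'; rewrite !in_fset1U.
  case/predU1P => [->|BF] /predU1P[->|B'F]; rewrite ?eqxx // => BB'.
  + exact: disj.
  + by rewrite fdisjoint_sym; exact: disj.
  + by move/trivIfsetP: trivF; apply.
- split=> [xNF|[B]].
    have [B] := (in_cover _ x).1 xNF; rewrite in_fset1U => /predU1P[->|BF] xB.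
      by exists M; [exact: mem_head|move: xB; rewrite in_fsetD => /andP[]].
    have [M' M'Ms xM'] : exists2 M', M' \in Ms & x \in M' by apply/covF/in_cover; exists B.
    by exists M'; rewrite // inE M'Ms orbT.
  move=> BMs xB; apply/in_cover; have [xF|xF] := boolP (x \in fcover F).
    by have [B' B'F xB'] := (in_cover F x).1 xF; exists B'; rewrite // in_fset1U B'F orbT.
  move: BMs; rewrite inE => /predU1P[eB|BMs].
    by exists N; [rewrite in_fset1U eqxx|apply: sub_N; rewrite -?eB].
  by case/negP: xF; apply/covF; exists B.
- by rewrite cardfsU1 /= -add1n leq_add // leq_b1.
rewrite in_fset1U => /predU1P[->|/subF[ne [M' M'Ms sub]]].
  by split=> //; exists M; rewrite ?mem_head // fsubsetDl.
by split=> //; exists M' => //; rewrite inE M'Ms orbT.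
Qed.

Section Matchings.
Variable R : realType.
Implicit Types (s : seq (plane R)) (u : plane R) (A : {fset plane R}).

(** Every second edge of the path through [s]; [behead s] yields the others. *)
Fixpoint pair_up s : seq {fset plane R} :=
  if s is v :: w :: s' then [fset v; w]%fset :: pair_up s' else [::].

Lemma path_edges_pair_up s e :
  (e \in path_edges s) = (e \in pair_up s) || (e \in pair_up (behead s)).
Proof.
elim: s => [//|v [//|w s] IH].
have -> : path_edges [:: v, w & s] = [fset v; w]%fset :: path_edges (w :: s) by [].
by rewrite inE IH /= inE -orbA [(e \in _) || (e \in pair_up s)]orbC.
Qed.

Lemma dotBl p q u : dot (p - q) u = dot p u - dot q u.
Proof. by rewrite /dot /=; ring. Qed.

Lemma edge_mem A v w : v \in A -> w \in A -> v != w -> [fset v; w]%fset \in edges A.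
Proof.
move=> vA wA vw; apply/imfsetP; exists (v, w) => //=.
by rewrite inE /= vw andbT; apply/allpairsP; exists (v, w).
Qed.

Lemma pair_up_edges A u s : all (fun v => v \in A) s -> monotone_path_in u s ->
  forall e, e \in pair_up s -> e \in edges A.
Proof.
have [k] := ubnP (size s); elim: k s => [//|k IH] [//|v [//|w s]] /= sk.
case/and3P=> vA wA sA /andP[vw ws] e; rewrite inE => /orP[/eqP->|].
  apply: edge_mem => //; apply/eqP => evw; move: vw.
  by rewrite evw dotBl subrr ltxx.
apply: IH => //; first by lia.
exact: path_sorted ws.
Qed.

Lemma dot_segment_bounds (e : {fset plane R}) u (x : plane R) (P : R -> Prop) :
  (forall a b t, 0 <= t <= 1 -> P a -> P b -> P ((1 - t) * a + t * b)) ->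
  (forall p, p \in e -> P (dot p u)) -> segment e x -> P (dot x u).
Proof.
move=> convP eP [p [q [t [pe qe t01 ->]]]].
rewrite (_ : dot _ u = (1 - t) * dot p u + t * dot q u); first by apply: convP => //; apply: eP.
by rewrite /dot /=; ring.
Qed.

Lemma pair_up_sub s e p : e \in pair_up s -> p \in e -> p \in s.
Proof.
have [k] := ubnP (size s); elim: k s => [//|k IH] [//|v [//|w s]] /= sk.
rewrite inE => /orP[/eqP->|es pe].
  by rewrite in_fset2 !inE => /orP[]->; rewrite ?orbT.
by rewrite !inE (IH s) ?orbT //; lia.
Qed.

(** The projection of an edge lies at or below its end [w], that of a later edge
    of [pair_up] strictly above: a whole edge of the path lies in between. *)
Lemma pair_up_trivIset u s : monotone_path_in u s ->
  trivIset [set e | e \in pair_up s]%classic (projection u).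
Proof.
have trans : transitive (fun v w : plane R => 0 < dot (w - v) u).
  by move=> y x z; rewrite !dotBl; lra.
have [k] := ubnP (size s); elim: k s => [//|k IH] [|v [|w s]] /= sk; try by move=> _ e e'.
case/andP=> vw ws.
have below y : projection u [fset v; w]%fset y -> y <= dot w u.
  move=> [x ex <-]; apply: (@dot_segment_bounds _ u x (fun r => r <= dot w u)) ex.
    move=> a b t /andP[t0 t1] ha hb.
    have : 0 <= (1 - t) * (dot w u - a) by rewrite mulr_ge0 //; lra.
    have : 0 <= t * (dot w u - b) by rewrite mulr_ge0 //; lra.
    lra.
  by move=> p; rewrite in_fset2 => /orP[]/eqP-> //; rewrite dotBl subr_gt0 in vw; exact: ltW.
have above e y : e \in pair_up s -> projection u e y -> dot w u < y.
  move=> es [x ex <-]; apply: (@dot_segment_bounds e u x (fun r => dot w u < r)) ex.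
    move=> a b t /andP[t0 t1] ha hb.
    have [->|t_neq0] := eqVneq t 0; first by lra.
    have : 0 <= (1 - t) * (a - dot w u) by rewrite mulr_ge0 //; lra.
    have : 0 < t * (b - dot w u) by rewrite mulr_gt0 ?subr_gt0 // lt_def t_neq0.
    lra.
  move=> p pe; have /allP/(_ p) := order_path_min trans ws.
  by rewrite dotBl subr_gt0; apply; exact: pair_up_sub es pe.
have off e y : e \in pair_up s -> projection u [fset v; w]%fset y -> ~ projection u e y.
  by move=> es /below yw /(above _ _ es) wy; have := le_lt_trans yw wy; rewrite ltxx.
have sk' : (size s < k)%N by lia.
move=> e e' /=; rewrite !inE => /orP[/eqP->|es] /orP[/eqP->|es'] // [y [h h']].
- by case: (off e' y).
- by case: (off e y).
by apply: (IH s sk' (path_sorted ws)) => //; exists y.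
Qed.

(** Edges with disjoint projections have no common endpoint, so monotonicity
    already makes [M] a matching. *)
Lemma sub_pair_up_monotone_matching A u s (M : {fset {fset plane R}}) : u != 0 ->
  all (fun v => v \in A) s -> monotone_path_in u s ->
  (forall e, e \in M -> e \in pair_up s) -> monotone_matching A M.
Proof.
move=> u0 sA mono Ms.
have triv : trivIset [set` M]%classic (projection u).
  by move=> e e' /Ms es /Ms es'; exact: (pair_up_trivIset mono).
split; last by exists u.
split; first by apply/fsubsetP => e /Ms; exact: pair_up_edges mono e.
apply/trivIfsetP => e e' eM e'M ee'; apply/fdisjointP => p pe; apply/negP => pe'.
case/eqP: ee'; apply: triv => //; exists (dot p u).
have ends f : p \in f -> projection u f (dot p u).
  move=> pf; exists p => //; exists p, p, 0; split=> //; first by rewrite lexx ler01.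
  by case: (p) => a b /=; rewrite subr0 !mul1r !mul0r !addr0.
by split; exact: ends.
Qed.

Lemma decomposition_of_cover A (F : seq (seq (plane R))) : monotone_path_cover A F ->
  exists2 Ms : {fset {fset {fset plane R}}},
    monotone_matching_decomposition A Ms & (#|` Ms| <= 2 * size F)%N.
Proof.
move=> [pathF covF].
pose halves := [seq pair_up s | s <- F] ++ [seq pair_up (behead s) | s <- F].
pose Ls := [seq [fset e in l]%fset | l <- halves].
have halfP l : l \in halves -> forall M : {fset {fset plane R}},
    (forall e, e \in M -> e \in l) -> monotone_matching A M.
  rewrite mem_cat => /orP[]/mapP[s sF ->] M Ml;
    have [/andP[_ sA] [u u0 mono]] := pathF s sF.
    exact: (sub_pair_up_monotone_matching u0 sA mono).
  apply: (sub_pair_up_monotone_matching u0 _ _ Ml); first by case: (s) sA => //= v s' /andP[].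
  by case: (s) mono => //= v s'; exact: path_sorted.
have [Ms [triv cov card sub]] := ex_disjoint_refinement Ls.
exists Ms; last by apply: leq_trans card _; rewrite size_map size_cat !size_map; lia.
have MsP N : N \in Ms -> exists2 l, l \in halves & forall e, e \in N -> e \in l.
  case/sub=> _ [_ /mapP[l lh ->] /fsubsetP Nl]; exists l => // e /Nl.
  by rewrite inE.
split=> // [N NM|].
  split; first by case: (sub N NM).
  by have [l lh Nl] := MsP N NM; exact: halfP lh _ Nl.
apply/fsetP => e; apply/idP/idP => [/cov[_ /mapP[l lh ->] el]|eA].
  have [|[/fsubsetP Msub _] _] := halfP l lh [fset e in l]%fset; last exact: Msub.
  by move=> f; rewrite inE.
have [s sF] := covF e eA; rewrite path_edges_pair_up => es.
apply/cov; case/orP: es => es.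
  exists [fset e in pair_up s]%fset; last by rewrite inE.
  by apply: map_f; rewrite mem_cat map_f.
exists [fset e in pair_up (behead s)]%fset; last by rewrite inE.
by apply: map_f; rewrite mem_cat (map_f (fun s => pair_up (behead s))) ?orbT.
Qed.

End Matchings.

(** * The theorem *)

Lemma powR_three_halves (R : realType) (x : R) : 0 <= x -> x `^ (3 / 2) = Num.sqrt x ^+ 3.
Proof.
by move=> x0; rewrite mulrC powRrM powR12_sqrt // powR_mulrn // sqrtr_ge0.
Qed.

Section Algorithm.
Variables (R : realType) (alpha : R).

(** Two tables give at most [40 * K ^ 3] paths, where [K = 10 * m * s] and
    [s <= 2 * sqrt n]. *)
Definition path_constant (m : nat) : R := 40 * (10 * m%:R) ^+ 3 * 8.

(** For the time, [K + 1 <= 20 * m * s] and [s ^ 2 <= 4 * n]. *)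
Lemma cover_algorithm (m : nat) : 0 < alpha -> alpha <= m%:R ->
  exists T : nat, forall (A : {fset plane R}) (pts : seq (plane R)),
    alpha_dense alpha A -> perm_eq pts (enum_fset A) ->
    exists (t : nat) (st : state R),
      [/\ exec (cover_program m) (initial_state pts) t st,
          (0 < #|` A|)%N -> (t <= T * #|` A| ^ 2)%N,
          valid_output pts st,
          monotone_path_cover A (output_paths pts st) &
          (size (output_paths pts st))%:R <= path_constant m * #|` A|%:R `^ (3 / 2)].
Proof.
move=> alpha0 alpha_m; have m0 : (0 < m)%N by rewrite -(ltr_nat R) (lt_le_trans alpha0).
have [c run] := @runs_cover_program R m m0.
exists (c * ((20 * m) ^ 4 * 16))%N => A pts dense ptsA.
have [s [n_s s_n [t [st [ex le [D [Rows [Cols [radD tabR tabC out]]]]]]]]] := run pts.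
rewrite (_ : #|` A| = size pts); last by rewrite (perm_size ptsA).
set n := size pts in n_s s_n *; exists t, st; split.
- exact: ex.
- move=> n0; apply: leq_trans le _; rewrite -mulnA leq_mul //.
  have s0 : (0 < s)%N by move: n_s; case: (s) => //; lia.
  have K1 : ((10 * (m * s)).+1 <= 20 * m * s)%N.
    by have : (0 < m * s)%N; [rewrite muln_gt0 m0|lia].
  apply: (@leq_trans ((20 * m * s) ^ 4)); first by rewrite leq_exp2r.
  rewrite expnMn -mulnA leq_mul // (_ : s ^ 4 = (s ^ 2) ^ 2)%N; last by rewrite -expnM.
  by apply: (@leq_trans ((4 * n) ^ 2)); [rewrite leq_exp2r|rewrite expnMn].
- apply/allP => p; rewrite out => /(swept_path_sound alpha0 ptsA alpha_m n_s radD tabR tabC)[+ _].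
  exact.
- rewrite /output_paths out.
  exact: (swept_monotone_cover alpha0 dense ptsA alpha_m n_s radD tabR tabC).
rewrite /output_paths size_map out size_cat.
set K := (10 * (m * s))%N.
have sizeK :
    (size (swept_paths K (m * s) Rows) + size (swept_paths K (m * s) Cols) <= 40 * K ^ 3)%N.
  by rewrite (_ : 40 * K ^ 3 = 20 * K ^ 3 + 20 * K ^ 3)%N ?leq_add ?size_swept_paths // -mulnDl.
apply: (@le_trans _ _ (40 * K ^ 3)%N%:R); first by rewrite ler_nat.
rewrite powR_three_halves // /path_constant /K mulnA natrM natrX natrM exprMn mulrA.
rewrite -[leRHS]mulrA natrM ler_wpM2l ?mulr_ge0 ?exprn_ge0 ?mulr_ge0 //.
rewrite (_ : 8 * _ = (2 * Num.sqrt n%:R) ^+ 3); last by rewrite exprMn; congr (_ * _); ring.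
rewrite ler_pXn2r ?nnegrE ?mulr_ge0 ?sqrtr_ge0 //.
rewrite -(ler_pXn2r (_ : 0 < 2)%N) ?nnegrE ?mulr_ge0 ?sqrtr_ge0 //.
rewrite exprMn sqr_sqrtr // (_ : 2 ^+ 2 = 4%:R :> R); last by ring.
by rewrite -natrX -natrM ler_nat.
Qed.

End Algorithm.

Theorem theorem4 (R : realType) (alpha : R) (alpha_gt0 : 0 < alpha) :
  (exists2 C : R, 0 < C &
    (forall (n : nat) (A : {fset plane R}),
       #|` A| = n -> general_position A -> alpha_dense alpha A ->
       exists2 F : seq (seq (plane R)),
         monotone_path_cover A F & (size F)%:R <= C * n%:R `^ (3 / 2)) /\
    (exists (prog : cmd) (T : nat),
       forall (n : nat) (A : {fset plane R}) (pts : seq (plane R)),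
         #|` A| = n -> general_position A -> alpha_dense alpha A ->
         perm_eq pts (enum_fset A) ->
         exists (t : nat) (st : state R),
           [/\ exec prog (initial_state pts) t st,
               (0 < n)%N -> (t <= T * n ^ 2)%N,
               valid_output pts st,
               monotone_path_cover A (output_paths pts st) &
               (size (output_paths pts st))%:R <= C * n%:R `^ (3 / 2)])) /\
  (exists2 C : R, 0 < C &
    forall (n : nat) (A : {fset plane R}),
      #|` A| = n -> general_position A -> alpha_dense alpha A ->
      exists2 F : {fset {fset {fset plane R}}},
        monotone_matching_decomposition A F &
        #|` F|%:R <= C * n%:R `^ (3 / 2)).
Proof.
set m := (Num.truncn alpha).+1.
have alpha_m : alpha <= m%:R by apply/ltW; rewrite truncnS_gt.
have [T algo] := cover_algorithm alpha_gt0 alpha_m.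
have C_gt0 : 0 < path_constant R m by rewrite !mulr_gt0 ?exprn_gt0 ?mulr_gt0 ?ltr0n.
have cover (A : {fset plane R}) : alpha_dense alpha A ->
    exists2 F, monotone_path_cover A F &
      (size F)%:R <= path_constant R m * #|` A|%:R `^ (3 / 2).
  move=> dense; have [t [st [_ _ _ covA sizeA]]] := algo A _ dense (perm_refl _).
  by exists (output_paths A st).
split; [exists (path_constant R m) => //; split|exists (2 * path_constant R m)].
- by move=> n A <- _ /cover.
- exists (cover_program m), T => n A pts <- _; exact: algo.
- by rewrite mulr_gt0.
move=> n A <- _ /cover[F covF sizeF].
have [Ms dec cardMs] := decomposition_of_cover covF; exists Ms => //.
apply: (@le_trans _ _ (2 * size F)%N%:R); first by rewrite ler_nat.
by rewrite natrM -mulrA ler_wpM2l.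
Qed.
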